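(* For any integer $n\ge 1$, the myopic strategy $\mathsf{M}^n$ is the optimal strategy of the $(\xi_0,n,x)$-bandit for all $\xi_0\in[0,1]$ and all $x\in\mathbb{R}$ (i.e. $W(\xi_0,n,x,\mathsf{M}^n)=V(\xi_0,n,x)$ for all such $\xi_0,x$), if and only if $$E_1[\varphi(u+X_1)]\ge E_1[\varphi(u+Y_1)]\qquad\text{for all }u\in\mathbb{R}.$$
   Context: Model. $F_1,F_2$ are continuous distributions on $\mathbb{R}$ with densities $f_1,f_2$. Two arms $X,Y$ produce payoffs $X_1,X_2,\dots$ and $Y_1,Y_2,\dots$ ($X_i$, $Y_i$ being the payoffs of trial $i$ from arms $X$, $Y$). Under hypothesis $H_1$ each $X_i$ has distribution $F_1$ and each $Y_i$ has distribution $F_2$; under hypothesis $H_2$ each $X_i$ has distribution $F_2$ and each $Y_i$ has distribution $F_1$; under each hypothesis the variables $X_1,Y_1,X_2,Y_2,\dots$ are independent. $E_1,E_2$ denote expectation under $H_1,H_2$, and for $\xi\in[0,1]$, $E_\xi[\cdot]:=\xi E_1[\cdot]+(1-\xi)E_2[\cdot]$ ($\xi$ is the prior probability of $H_1$). Strategies. Let $\mathcal{F}_i:=\sigma\{(X_1,Y_1),\dots,(X_i,Y_i)\}$, with $\mathcal{F}_0$ trivial. A strategy for $n$ trials is $\theta=\{\theta_1,\dots,\theta_n\}$ where each $\theta_i$ is an $\mathcal{F}_{i-1}$-measurable random variable with values in $\{0,1\}$; $\theta_i=1$ means arm $X$ is selected in trial $i$ and $\theta_i=0$ means arm $Y$ is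 selected. $\Theta_n$ is the set of all such strategies. The payoff received in trial $i$ is $Z_i^\theta:=\theta_iX_i+(1-\theta_i)Y_i$. Utility. $\varphi$ is a suitable measurable function on $\mathbb{R}$, called the utility function. The $(\xi_0,n,x)$-bandit is the problem with $n$ trials, initial fund $x$ and prior probability $\xi_0$; its expected utility under $\theta\in\Theta_n$ is $W(\xi_0,n,x,\theta):=E_{\xi_0}[\varphi(x+\sum_{i=1}^nZ_i^\theta)]$, and $V(\xi_0,n,x):=\sup_{\theta\in\Theta_n}W(\xi_0,n,x,\theta)$. A strategy attaining this supremum is optimal. Posterior probabilities. For $\theta\in\Theta_n$ put $\xi_0^\theta:=\xi_0$ and, if the payoff of trial $i+1$ is $s$, $\xi_{i+1}^\theta:=\frac{\xi_i^\theta f_1(s)}{\xi_i^\theta f_1(s)+(1-\xi_i^\theta)f_2(s)}$ if $\theta_{i+1}=1$, and $\xi_{i+1}^\theta:=\frac{\xi_i^\theta f_2(s)}{\xi_i^\theta f_2(s)+(1-\xi_i^\theta)f_1(s)}$ if $\theta_{i+1}=0$. Myopic strategy. $\mathsf{M}^n$: in trial $i$, play $X$ if $\xi_{i-1}^{\mathsf{M}^n}\ge\frac12$ and play $Y$ if $\xi_{i-1}^{\mathsf{M}^n}<\frac12$.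
   Formalization: Strategies may use only the payoffs actually received (with payoffs of unplayed arms the claim is false), and ''suitable'' φ means all expected utilities are finite and E_1[φ(u+X_1)], E_1[φ(u+Y_1)] are continuous in u. *)

(* Defs.v *)
From HB Require Import structures.
From mathcomp Require Import all_boot all_order all_algebra.
From mathcomp Require Import all_classical all_reals all_analysis.
Import Order.TTheory GRing.Theory Num.Theory.
Import numFieldNormedType.Exports.

Set Implicit Arguments.
Unset Strict Implicit.
Unset Printing Implicit Defensive.

Local Open Scope classical_set_scope.
Local Open Scope ring_scope.

(** Trials are numbered from 0: index [i] below is trial [i + 1], so that [X i]
    is the payoff X_{i+1} and [theta i] is the choice theta_{i+1}. *)

Section Probability.
Context {R : realType} {d : measure_display} {Omega : measurableType d}.

(** Mutual independence of a family of real random variables, indexed by any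
    type with decidable equality: the product rule over finite subfamilies. *)
Definition mutually_independent {I : eqType} (P : probability Omega R)
    (Z : I -> {mfun Omega >-> R}) : Prop :=
  forall (J : seq I) (B : I -> set R), uniq J ->
    (forall j, measurable (B j)) ->
    P (\big[setI/setT]_(j <- J) (Z j @^-1` B j)) =
    (\prod_(j <- J) P (Z j @^-1` B j))%E.

Definition has_law (P : probability Omega R) (Z : {mfun Omega >-> R})
    (F : probability (measurableTypeR R) R) : Prop :=
  forall A : set (measurableTypeR R), measurable A -> distribution P Z A = F A.

(** The sigma-algebra generated by [Z 0], ..., [Z (i - 1)]; trivial for
    [i = 0]. *)
Definition sigma_before {d' : measure_display} {U : measurableType d'}
    (Z : nat -> Omega -> U) (i : nat) : set_system Omega :=
  <<s \bigcup_(j in [set j : nat | (j < i)%N])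
        preimage_set_system setT (Z j) measurable >>.

End Probability.

Definition is_density_of {R : realType} (f : R -> R)
    (F : probability (measurableTypeR R) R) : Prop :=
  [/\ measurable_fun [set: R] f, forall s, 0 <= f s
    & forall A : set (measurableTypeR R), measurable A ->
        F A = (\int[lebesgue_measure]_(s in A) (f s)%:E)%E].

Section Bandit.
Context {R : realType} {d : measure_display} {Omega : measurableType d}.
(* [P1] and [P2] are the laws on [Omega] under the hypotheses H_1 and H_2. *)
Variables (P1 P2 : probability Omega R) (X Y : nat -> {mfun Omega >-> R}).
Variables (F1 F2 : probability (measurableTypeR R) R) (f1 f2 : R -> R).

(* All the variables X_1, Y_1, X_2, Y_2, ... as a single family: [inl i] is
   [X i] and [inr i] is [Y i]. *)
Definition all_payoffs (k : nat + nat) : {mfun Omega >-> R} :=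
  match k with inl i => X i | inr i => Y i end.

Record bandit_model : Prop := BanditModel {
  density1 : is_density_of f1 F1;
  density2 : is_density_of f2 F2;
  law_X_H1 : forall i, has_law P1 (X i) F1;
  law_Y_H1 : forall i, has_law P1 (Y i) F2;
  law_X_H2 : forall i, has_law P2 (X i) F2;
  law_Y_H2 : forall i, has_law P2 (Y i) F1;
  indep_H1 : mutually_independent P1 all_payoffs;
  indep_H2 : mutually_independent P2 all_payoffs }.

(* [theta i w = true] selects arm X, [theta i w = false] selects arm Y. *)
Definition payoff (theta : nat -> Omega -> bool) (i : nat) (w : Omega) : R :=
  if theta i w then X i w else Y i w.

Definition total_payoff (theta : nat -> Omega -> bool) (n : nat) (w : Omega) :
    R :=
  \sum_(i < n) payoff theta i w.

(** [strategy n theta]: the first [n] entries of [theta] form an element of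
    Theta_n (the later entries are irrelevant). Besides being adapted to
    sigma((X_1, Y_1), ..., (X_i, Y_i)), each choice is a function of the payoffs
    received so far: bandit feedback. With the first clause alone the payoffs of
    the arms that were not selected could also be used. Then with normal
    densities of variance 1 and means 1 and 0, and identity utility, playing X
    and then X iff X_1 > Y_1 has strictly larger expected utility, for n = 2
    and prior 1/2, than playing X and then X iff X_1 >= 1/2, which is the
    myopic strategy. *)
Definition strategy (n : nat) (theta : nat -> Omega -> bool) : Prop :=
  forall i, (i < n)%N ->
    sigma_before (fun j w => (X j w, Y j w)) i [set w | theta i w] /\
    sigma_before (payoff theta) i [set w | theta i w].

Definition posterior_step (xi : R) (b : bool) (s : R) : R :=
  if b then xi * f1 s / (xi * f1 s + (1 - xi) * f2 s)
  else xi * f2 s / (xi * f2 s + (1 - xi) * f1 s).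

Fixpoint posterior (xi0 : R) (theta : nat -> Omega -> bool) (i : nat)
    (w : Omega) : R :=
  if i is j.+1 then
    posterior_step (posterior xi0 theta j w) (theta j w) (payoff theta j w)
  else xi0.

(* The myopic strategy is defined in terms of its own posterior; this is the
   recursion that solves the circularity, see [myopicE]. *)
Fixpoint myopic_posterior (xi0 : R) (i : nat) (w : Omega) : R :=
  if i is j.+1 then
    let xi := myopic_posterior xi0 j w in
    let b := 2^-1 <= xi in
    posterior_step xi b (if b then X j w else Y j w)
  else xi0.

Definition myopic (xi0 : R) (i : nat) (w : Omega) : bool :=
  2^-1 <= myopic_posterior xi0 i w.

Lemma posterior_myopic xi0 i w :
  posterior xi0 (myopic xi0) i w = myopic_posterior xi0 i w.
Proof. by elim: i => //= i ->. Qed.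

Lemma myopicE xi0 i w :
  myopic xi0 i w = (2^-1 <= posterior xi0 (myopic xi0) i w).
Proof. by rewrite posterior_myopic. Qed.

Variable phi : R -> R.

Definition expected_utility (xi0 : R) (n : nat) (x : R)
    (theta : nat -> Omega -> bool) : \bar R :=
  (xi0%:E * 'E_P1[fun w => phi (x + total_payoff theta n w)%R]
   + (1 - xi0)%:E * 'E_P2[fun w => phi (x + total_payoff theta n w)%R])%E.

Definition value (xi0 : R) (n : nat) (x : R) : \bar R :=
  ereal_sup [set expected_utility xi0 n x theta | theta in strategy n].

Definition optimal (xi0 : R) (n : nat) (x : R)
    (theta : nat -> Omega -> bool) : Prop :=
  strategy n theta /\ expected_utility xi0 n x theta = value xi0 n x.

(** The standing assumptions on the utility function: all expected utilities
    exist and are finite, and one-trial expected utilities depend continuously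
    on the initial fund. Continuity holds in particular when [phi] is bounded.
    It cannot be dropped: for [n >= 2] the fund before the last trial has a
    density, so optimality only sees the one-trial expected utilities up to a
    Lebesgue-null set of funds. *)
Record suitable_utility : Prop := SuitableUtility {
  utility_measurable : measurable_fun [set: R] phi;
  utility_integrable : forall n x theta, strategy n theta ->
    P1.-integrable setT (fun w => (phi (x + total_payoff theta n w))%:E) /\
    P2.-integrable setT (fun w => (phi (x + total_payoff theta n w))%:E);
  utility_continuous_X :
    continuous (fun u : R => 'E_P1[fun w => phi (u + X 0%N w)%R]%E);
  utility_continuous_Y :
    continuous (fun u : R => 'E_P1[fun w => phi (u + Y 0%N w)%R]%E)
}.

End Bandit.

(* Main.v *)
From HB Require Import structures.
Require Import Defs.
From mathcomp Require Import all_boot all_order all_algebra.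
From mathcomp Require Import all_classical all_reals all_analysis.
From mathcomp Require Import measurable_realfun ring lra.
Import Order.TTheory GRing.Theory Num.Theory.
Import numFieldNormedType.Exports.
Local Open Scope classical_set_scope.
Local Open Scope ring_scope.

(** Let v_k(a, b, x) be the optimal expected utility of k trials with fund x and
    unnormalised weights a, b of the two hypotheses, and let Delta_k(a, b, x) be
    the gain of starting with X instead of Y when k optimal trials follow.
    Playing X then Y or Y then X leads to the same final state, which yields
      Delta_{k+1}(a, b, x) =
        int (Delta_k^+(a f1(s), b f2(s), x+s) - Delta_k^+(b f1(s), a f2(s), x+s)) ds,
    whereas Delta_0 is (a - b) times the difference of the one-trial utilities.
    So, if this difference is nonnegative, Delta_k is nondecreasing in a and
    nonincreasing in b; as it vanishes at a = b, starting with X is optimal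
    iff a >= b, up to ties. For an arbitrary strategy the posterior is the
    density of P1 with respect to xi P1 + (1 - xi) P2 on the observed history,
    so v_{n-i}(xi_i, 1 - xi_i, x + Z_1 + ... + Z_i) has nonincreasing
    expectation in i, and constant expectation if the strategy is myopic. *)
(** * The value function *)

Section parametric_integrals.
Context {d d' : measure_display} {T : measurableType d} {U : measurableType d'}
  {R : realType} (mu : {sigma_finite_measure set U -> \bar R}).

Lemma measurable_integral_param (F : T * U -> \bar R) :
  measurable_fun setT F ->
  measurable_fun [set: T] (fun t => \int[mu]_s F (t, s))%E.
Proof.
move=> mF; rewrite [X in measurable_fun _ X](_ : _ = fun t =>
    (fubini_F mu F^\+ t - fubini_F mu F^\- t)%E); last first.
  apply/funext => t; rewrite integralE.
  by congr (_ - _)%E; apply: eq_integral => s _; rewrite !(funeposE, funenegE).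
apply: emeasurable_funB; apply: measurable_fun_fubini_tonelli_F => //.
- exact: measurable_funepos.
- exact: measurable_funeneg.
Qed.

Lemma measurable_Rintegral_param (F : T * U -> R) :
  measurable_fun setT F ->
  measurable_fun [set: T] (fun t => \int[mu]_s F (t, s)).
Proof.
move=> mF; apply: (measurableT_comp (fine_measurable measurableT)).
by apply: (measurable_integral_param (EFin \o F)); exact/measurable_EFinP.
Qed.

End parametric_integrals.

Section value_function.
Context {R : realType} (f1 f2 phi : R -> R).
Local Notation mu := (@lebesgue_measure R).

(* The sum of the expected absolute utilities of all [2 ^ k] fixed choices of
   the arms, each payoff having density [f1] or [f2]; it bounds [bandit_value]. *)
Fixpoint envelope (k : nat) (x : R) : \bar R :=
  if k is k'.+1 then
    \int[mu]_s (envelope k' (x + s)%R * (f1 s + f2 s)%:E)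
  else `|phi x|%:E.

(* The arguments [a] and [b] are unnormalised weights of the two hypotheses, so
   that Bayes' rule becomes multiplication by the densities, without any
   division. *)
Fixpoint bandit_value (k : nat) (a b x : R) : R :=
  if k is k'.+1 then
    Num.max (\int[mu]_s bandit_value k' (a * f1 s) (b * f2 s) (x + s))
         (\int[mu]_s bandit_value k' (b * f1 s) (a * f2 s) (x + s))
  else (a + b) * phi x.

Definition next_value (F : R -> R -> R -> R) (a b x : R) : R :=
  \int[mu]_s F (a * f1 s) (b * f2 s) (x + s).

Definition advantage (k : nat) (a b x : R) : R :=
  next_value (bandit_value k) a b x - next_value (bandit_value k) b a x.

Definition enveloped (k : nat) (F : R -> R -> R -> R) : Prop :=
  measurable_fun setT (fun p => F p.1.1 p.1.2 p.2) /\
  exists2 C, 0 <= C & forall a b x, 0 <= a -> 0 <= b ->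
    (`|F a b x|%:E <= (C * (a + b))%:E * envelope k x)%E.

Hypotheses (mf1 : measurable_fun [set: R] f1) (mf2 : measurable_fun [set: R] f2).
Hypotheses (f1_ge0 : forall s, 0 <= f1 s) (f2_ge0 : forall s, 0 <= f2 s).
Hypothesis mphi : measurable_fun [set: R] phi.

Lemma envelope_ge0 k x : (0 <= envelope k x)%E.
Proof.
elim: k x => [|k IH] x /=; first by rewrite lee_fin.
by apply: integral_ge0 => s _; rewrite mule_ge0// lee_fin addr_ge0.
Qed.

Lemma measurable_envelope k : measurable_fun [set: R] (envelope k).
Proof.
elim: k => [|k IH] /=; first by apply/measurable_EFinP; exact: measurableT_comp.
pose F (p : R * R) := (envelope k (p.1 + p.2)%R * (f1 p.2 + f2 p.2)%:E)%E.
apply: (@measurable_integral_param _ _ _ _ _ mu F); rewrite /F.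
apply: emeasurable_funM.
  by apply: (measurableT_comp IH); exact: measurable_funD.
by apply/measurable_EFinP/measurable_funD; exact: measurableT_comp.
Qed.

Lemma measurable_uncurry3 {d} {T : measurableType d} (F : R -> R -> R -> R)
    (g h l : T -> R) :
  measurable_fun setT (fun p => F p.1.1 p.1.2 p.2) ->
  measurable_fun [set: T] g -> measurable_fun [set: T] h ->
  measurable_fun [set: T] l ->
  measurable_fun [set: T] (fun t => F (g t) (h t) (l t)).
Proof.
move=> mF mg mh ml.
apply: (measurableT_comp mF (g := fun t => (g t, h t, l t))).
by apply: measurable_fun_pair => //; exact: measurable_fun_pair.
Qed.

Lemma measurable_next_integrand k F a b x : enveloped k F ->
  measurable_fun [set: R] (fun s => F (a * f1 s) (b * f2 s) (x + s)).
Proof.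
move=> [mF _]; apply: measurable_uncurry3 => //; first exact: measurable_funM.
  exact: measurable_funM.
exact: measurable_funD.
Qed.

Lemma envelopedP k F : enveloped k F -> exists2 C, 0 <= C &
  forall a b x, 0 <= a -> 0 <= b ->
    (\int[mu]_s `|F (a * f1 s) (b * f2 s) (x + s)%R|%:E <=
     (C * (a + b))%:E * envelope k.+1 x)%E.
Proof.
move=> hF; have [mF [C C0 hC]] := hF; exists C => // a b x a0 b0.
have mE : measurable_fun [set: R]
    (fun s => envelope k (x + s)%R * (f1 s + f2 s)%:E)%E.
  apply: emeasurable_funM.
    by apply: (measurableT_comp (measurable_envelope k)); exact: measurable_funD.
  by apply/measurable_EFinP/measurable_funD.
have E0 s : (0 <= envelope k (x + s)%R * (f1 s + f2 s)%:E)%E.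
  by rewrite mule_ge0 ?envelope_ge0// lee_fin addr_ge0.
rewrite [envelope _.+1 _]/= -ge0_integralZl//; last by rewrite lee_fin mulr_ge0// addr_ge0.
apply: ge0_le_integral => //.
- apply/measurable_EFinP; apply: measurableT_comp => //.
  exact: measurable_next_integrand hF.
- exact: measurable_funeM.
move=> s _; apply: (le_trans (hC _ _ _ _ _)); rewrite ?mulr_ge0//.
rewrite [leRHS]muleCA -EFinM [leLHS]muleC; apply: lee_wpmul2l.
  exact: envelope_ge0.
rewrite lee_fin -mulrA ler_wpM2l//.
have := f1_ge0 s; have := f2_ge0 s; nra.
Qed.

Hypothesis envelope_fin : forall k x, (envelope k x < +oo)%E.

Lemma enveloped_next_integrable k F a b x : 0 <= a -> 0 <= b ->
  enveloped k F ->
  mu.-integrable setT (EFin \o (fun s => F (a * f1 s) (b * f2 s) (x + s))).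
Proof.
move=> a0 b0 hF; apply/integrableP; split.
  by apply/measurable_EFinP; exact: measurable_next_integrand hF.
have [C C0 /(_ a b x a0 b0) hC] := envelopedP _ _ hF.
rewrite (le_lt_trans hC)// lte_mul_pinfty// lee_fin mulr_ge0// addr_ge0//.
Qed.

Lemma enveloped_next k F : enveloped k F -> enveloped k.+1 (next_value F).
Proof.
move=> hF; have [C C0 hC] := envelopedP _ _ hF; split.
  pose H (p : R * R * R * R) := F (p.1.1.1 * f1 p.2) (p.1.1.2 * f2 p.2) (p.1.2 + p.2).
  apply: (@measurable_Rintegral_param _ _ _ _ _ mu H); rewrite /H.
  have [mF _] := hF; apply: measurable_uncurry3 => //.
  - apply: measurable_funM; last exact: measurableT_comp.
    by do 2 apply: measurableT_comp => //.
  - apply: measurable_funM; last exact: measurableT_comp.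
    by do 2 apply: measurableT_comp => //.
  - by apply: measurable_funD => //; exact: measurableT_comp.
exists C => // a b x a0 b0; rewrite (le_trans _ (hC _ _ _ a0 b0))//.
have iF := enveloped_next_integrable _ _ _ _ x a0 b0 hF.
rewrite EFin_normr_Rintegral//; apply: (le_trans (le_abse_integral _ _ _)) => //.
by apply: (measurable_int mu).
Qed.

Lemma enveloped_swap k F : enveloped k F -> enveloped k (fun a b => F b a).
Proof.
move=> [mF [C C0 hC]]; split.
  by apply: measurable_uncurry3 => //; exact: measurableT_comp.
by exists C => // a b x a0 b0; rewrite (addrC a) hC.
Qed.

Lemma enveloped_dominated k (F G : R -> R -> R -> R) :
  measurable_fun setT (fun p : R * R * R => G p.1.1 p.1.2 p.2) ->
  (forall a b x, `|G a b x| <= `|F a b x| + `|F b a x|) ->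
  enveloped k F -> enveloped k G.
Proof.
move=> mG GF hF; split=> //.
have [_ [C C0 hC]] := hF; exists (C + C); first exact: addr_ge0.
move=> a b x a0 b0; rewrite (@le_trans _ _ (`|F a b x|%:E + `|F b a x|%:E)%E)//.
  by rewrite -EFinD lee_fin GF.
rewrite mulrDl EFinD ge0_muleDl ?lee_fin ?mulr_ge0 ?addr_ge0//.
by apply: leeD; [exact: hC|rewrite (addrC a); exact: hC].
Qed.

Lemma enveloped_value k : enveloped k (bandit_value k).
Proof.
elim: k => [|k IH].
  split; last first.
    exists 1 => // a b x a0 b0 /=.
    by rewrite mul1r normrM (ger0_norm (addr_ge0 _ _)).
  apply: measurable_funM; last exact: measurableT_comp.
  by apply: measurable_funD; exact: measurableT_comp.
have hX := enveloped_next _ _ IH; have hY := enveloped_swap _ _ hX.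
apply: (enveloped_dominated _ _ _ _ _ hX); first by apply: measurable_maxr; [case: hX|case: hY].
move=> a b x /=; rewrite -/(next_value _ a b x) -/(next_value _ b a x).
by case: (leP (next_value (bandit_value k) a b x)) => _; rewrite ?lerDl ?lerDr.
Qed.

Lemma bandit_valueS k a b x : bandit_value k.+1 a b x =
  Num.max (next_value (bandit_value k) a b x) (next_value (bandit_value k) b a x).
Proof. by []. Qed.

Lemma bandit_valueC k a b x : bandit_value k a b x = bandit_value k b a x.
Proof. by case: k => [|k] /=; [rewrite addrC|rewrite maxC]. Qed.

Lemma bandit_value_homogeneous k c a b x : 0 <= c -> 0 <= a -> 0 <= b ->
  bandit_value k (c * a) (c * b) x = c * bandit_value k a b x.
Proof.
move=> c0; elim: k a b x => [|k IH] a b x a0 b0 /=; first by rewrite -mulrDr mulrA.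
have nextZ p r : 0 <= p -> 0 <= r ->
    next_value (bandit_value k) (c * p) (c * r) x =
    c * next_value (bandit_value k) p r x.
  move=> p0 r0; rewrite -RintegralZl//; last first.
    exact: enveloped_next_integrable (enveloped_value k).
  by apply: eq_Rintegral => s _; rewrite -!mulrA IH ?mulr_ge0.
by rewrite -!/(next_value _ _ _ _) !nextZ// maxr_pMr.
Qed.

Let next_integrable k a b x (a0 : 0 <= a) (b0 : 0 <= b) :=
  enveloped_next_integrable _ _ a b x a0 b0 (enveloped_value k).

Lemma double_integrable k a b x : 0 <= a -> 0 <= b ->
  (mu \x mu)%E.-integrable setT (fun p : R * R =>
    (bandit_value k (b * f1 p.1 * f2 p.2) (a * f2 p.1 * f1 p.2)
       (x + p.1 + p.2))%:E).
Proof.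
move=> a0 b0; have mV : measurable_fun setT (fun p : R * R =>
    (bandit_value k (b * f1 p.1 * f2 p.2) (a * f2 p.1 * f1 p.2)
       (x + p.1 + p.2))%:E).
  apply/measurable_EFinP.
  apply: measurable_uncurry3; first by case: (enveloped_value k).
  - apply: measurable_funM; last exact: measurableT_comp.
    by apply: measurable_funM => //; exact: measurableT_comp.
  - apply: measurable_funM; last exact: measurableT_comp.
    by apply: measurable_funM => //; exact: measurableT_comp.
  - by apply: measurable_funD => //; exact: measurable_funD.
apply/integrable12ltyP => //.
have mE : measurable_fun [set: R]
    (fun s => envelope k.+1 (x + s)%R * (f1 s + f2 s)%:E)%E.
  apply: emeasurable_funM.
    apply: (measurableT_comp (measurable_envelope k.+1)).
    exact: measurable_funD.
  by apply/measurable_EFinP/measurable_funD.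
have hV := enveloped_swap _ _ (enveloped_value k).
have [C C0 hC] := envelopedP _ _ hV.
apply: (@le_lt_trans _ _ (\int[mu]_s ((C * (a + b))%:E *
    (envelope k.+1 (x + s)%R * (f1 s + f2 s)%:E)))%E).
  pose H p : \bar R := `|(bandit_value k (b * f1 p.1 * f2 p.2)
    (a * f2 p.1 * f1 p.2) (x + p.1 + p.2))%:E|%E.
  have mH : measurable_fun setT H by apply: measurableT_comp.
  apply: ge0_le_integral => //.
  - by move=> s _; exact: integral_ge0.
  - exact: (measurable_integral_param mu H).
  - exact: measurable_funeM.
  move=> s _; have := hC (a * f2 s) (b * f1 s) (x + s).
  move=> /(_ (mulr_ge0 a0 (f2_ge0 s)) (mulr_ge0 b0 (f1_ge0 s))) /le_trans; apply.
  rewrite [leRHS]muleCA -EFinM [leLHS]muleC; apply: lee_wpmul2l.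
    exact: envelope_ge0.
  rewrite lee_fin -mulrA ler_wpM2l//.
  have := f1_ge0 s; have := f2_ge0 s; nra.
rewrite ge0_integralZl//; last 2 first.
  - by move=> s _; rewrite mule_ge0 ?envelope_ge0// lee_fin addr_ge0.
  - by rewrite lee_fin mulr_ge0// addr_ge0.
by rewrite lte_mul_pinfty ?(envelope_fin k.+2 x)// lee_fin mulr_ge0// addr_ge0.
Qed.

Lemma EFin_next_value k a b x : 0 <= a -> 0 <= b ->
  (next_value (bandit_value k) a b x)%:E =
  (\int[mu]_s (bandit_value k (a * f1 s) (b * f2 s) (x + s))%:E)%E.
Proof.
move=> a0 b0; rewrite /next_value /Rintegral fineK//.
by apply: integrable_fin_num => //; exact: next_integrable.
Qed.

(* Playing X then Y yields the same final state as Y then X, hence the swap of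
   the two integration variables. *)
Lemma next_next_exchange k a b x : 0 <= a -> 0 <= b ->
  next_value (fun p r => next_value (bandit_value k) r p) a b x =
  next_value (fun p r => next_value (bandit_value k) r p) b a x.
Proof.
move=> a0 b0.
pose H p := (bandit_value k (b * f1 p.1 * f2 p.2) (a * f2 p.1 * f1 p.2)
  (x + p.1 + p.2))%:E.
transitivity (fine (\int[mu]_s \int[mu]_t H (t, s))%E).
  congr fine; apply: eq_integral => s _; rewrite EFin_next_value ?mulr_ge0//.
  apply: eq_integral => t _; rewrite /H/=.
  by rewrite (mulrAC b) (mulrAC a) (addrAC x).
rewrite -(Fubini (double_integrable k a b x a0 b0)).
congr fine; apply: eq_integral => s _; rewrite EFin_next_value ?mulr_ge0//.
by apply: eq_integral => t _; rewrite /H/= bandit_valueC.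
Qed.

Lemma bandit_value_advantage k a b x : bandit_value k.+1 a b x =
  next_value (bandit_value k) b a x + Num.max (advantage k a b x) 0.
Proof.
by rewrite bandit_valueS addr_maxr addr0 /advantage addrC subrK.
Qed.

Lemma enveloped_advantage k :
  enveloped k.+1 (fun a b x => Num.max (advantage k a b x) 0).
Proof.
have hX := enveloped_next _ _ (enveloped_value k).
have hY := enveloped_swap _ _ hX.
apply: (enveloped_dominated _ _ _ _ _ hX).
  apply: measurable_maxr => //.
  by apply: measurable_funB; [case: hX|case: hY].
move=> a b x; rewrite /advantage.
case: (leP (next_value _ a b x - next_value _ b a x) 0) => _.
  by rewrite normr0 addr_ge0.
by rewrite ler_normB.
Qed.

(* By the exchange lemma the terms in which both arms are played cancel; what is
   left is monotone in the weights as soon as [advantage k] is. *)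
Lemma advantageS k a b x : 0 <= a -> 0 <= b ->
  advantage k.+1 a b x =
  next_value (fun a b x => Num.max (advantage k a b x) 0) a b x -
  next_value (fun a b x => Num.max (advantage k a b x) 0) b a x.
Proof.
move=> a0 b0.
have nextE p r : 0 <= p -> 0 <= r -> next_value (bandit_value k.+1) p r x =
    next_value (fun p r => next_value (bandit_value k) r p) p r x +
    next_value (fun a b x => Num.max (advantage k a b x) 0) p r x.
  move=> p0 r0; rewrite /next_value -RintegralD//.
  - by apply: eq_Rintegral => s _; rewrite -bandit_value_advantage.
  - have := enveloped_swap _ _ (enveloped_next _ _ (enveloped_value k)).
    exact: enveloped_next_integrable.
  - exact: enveloped_next_integrable (enveloped_advantage k).
rewrite /advantage !nextE// next_next_exchange//.
by rewrite opprD addrACA subrr add0r.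
Qed.

Lemma advantage0 a b x : 0 <= a -> 0 <= b -> advantage 0 a b x =
  (a - b) * (\int[mu]_s (phi (x + s) * f1 s) - \int[mu]_s (phi (x + s) * f2 s)).
Proof.
move=> a0 b0.
have i1 : mu.-integrable setT (EFin \o (fun s => phi (x + s) * f1 s)).
  have := next_integrable 0 1 0 x ler01 (lexx 0); congr (integrable _ _ _).
  by apply/funext => s /=; congr EFin; ring.
have i2 : mu.-integrable setT (EFin \o (fun s => phi (x + s) * f2 s)).
  have := next_integrable 0 0 1 x (lexx 0) ler01; congr (integrable _ _ _).
  by apply/funext => s /=; congr EFin; ring.
have nextE p r : next_value (bandit_value 0) p r x =
    p * (\int[mu]_s (phi (x + s) * f1 s)) + r * (\int[mu]_s (phi (x + s) * f2 s)).
  have iZ c f : mu.-integrable setT (EFin \o f) ->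
      mu.-integrable setT (EFin \o (fun s => c * f s)) by exact: integrableZl.
  rewrite -!RintegralZl// -RintegralD//; [|exact: iZ|exact: iZ].
  by apply: eq_Rintegral => s _ /=; ring.
by rewrite /advantage !nextE; ring.
Qed.

Hypothesis f1_better :
  forall u, \int[mu]_s (phi (u + s) * f2 s) <= \int[mu]_s (phi (u + s) * f1 s).

Lemma advantage_monotone k a a' b b' x : 0 <= a <= a' -> 0 <= b' <= b ->
  advantage k a b x <= advantage k a' b' x.
Proof.
elim: k a a' b b' x => [|k IH] a a' b b' x /andP[a0 aa'] /andP[b'0 b'b].
  have a'0 := le_trans a0 aa'; have b0 := le_trans b'0 b'b.
  rewrite !advantage0// ler_wpM2r ?subr_ge0//.
  lra.
have a'0 := le_trans a0 aa'; have b0 := le_trans b'0 b'b.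
have le_next p p' r r' : 0 <= p <= p' -> 0 <= r' <= r ->
    next_value (fun a b x => Num.max (advantage k a b x) 0) p r x <=
    next_value (fun a b x => Num.max (advantage k a b x) 0) p' r' x.
  move=> /andP[p0 pp'] /andP[r'0 r'r].
  have p'0 := le_trans p0 pp'; have r0 := le_trans r'0 r'r.
  apply: le_Rintegral => //;
    try exact: enveloped_next_integrable (enveloped_advantage k).
  move=> s _; rewrite ge_max !le_max lexx orbT andbT IH//.
    by rewrite mulr_ge0//= ler_wpM2r.
  by rewrite mulr_ge0//= ler_wpM2r.
by rewrite !advantageS// lerB// le_next ?b'0 ?a0.
Qed.

Lemma advantage_ge0 k a b x : 0 <= b <= a -> 0 <= advantage k a b x.
Proof.
move=> /andP[b0 ba]; have := advantage_monotone k b a b b x.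
by rewrite b0 ba lexx => /(_ isT isT); rewrite {1}/advantage subrr.
Qed.

Lemma bandit_value_left k a b x : 0 <= b <= a ->
  bandit_value k.+1 a b x = next_value (bandit_value k) a b x.
Proof. by move=> /advantage_ge0 h; rewrite bandit_valueS max_l// -subr_ge0 h. Qed.

Lemma bandit_value_right k a b x : 0 <= a <= b ->
  bandit_value k.+1 a b x = next_value (bandit_value k) b a x.
Proof. by move=> ?; rewrite bandit_valueC bandit_value_left. Qed.

End value_function.

(** * Independence of the past *)

Lemma integral_probability_cst {d : measure_display} {T : measurableType d}
    {R : realType} (P : probability T R) (c : \bar R) : (\int[P]_w c = c)%E.
Proof.
by rewrite integral_cst// [X in (_ * X)%E](_ : _ = 1%E) ?mule1//;
  exact: probability_setT.
Qed.

Lemma integral_density {R : realType} (F : probability (measurableTypeR R) R)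
    (f : R -> R) (g : measurableTypeR R -> \bar R) :
  is_density_of f F -> measurable_fun setT g -> (forall s, (0 <= g s)%E) ->
  (\int[F]_s g s = \int[lebesgue_measure]_s (g s * (f s)%:E))%E.
Proof.
move=> [mf f0 Ff] mg g0.
have mEf : measurable_fun setT (EFin \o f : measurableTypeR R -> \bar R).
  exact/measurable_EFinP.
have Fmu : F `<< (@lebesgue_measure R).
  apply/null_content_dominatesP => A mA A0; rewrite Ff//.
  by apply: null_set_integral => //; exact: measurable_funTS.
rewrite -(Radon_Nikodym_SigmaFinite.change_of_variables Fmu g0 measurableT mg).
have RN_int := Radon_Nikodym_SigmaFinite.f_integrable Fmu.
apply: ae_eq_integral => //.
- by apply: emeasurable_funM => //; exact: measurable_int RN_int.
- exact: emeasurable_funM.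
have : ae_eq lebesgue_measure setT
    (Radon_Nikodym_SigmaFinite.f F lebesgue_measure) (EFin \o f).
  apply: integral_ae_eq => // E _ mE.
  by rewrite -Radon_Nikodym_SigmaFinite.f_integral//; exact: Ff.
by apply: filterS => s Fs /Fs ->.
Qed.

Section independent_pair.
Context {d d' : measure_display} {Omega : measurableType d}
  {S : measurableType d'} {R : realType} (P : probability Omega R).

Lemma integral_independent_pair (h : {mfun Omega >-> S})
    (Z : {mfun Omega >-> R})
    (F : probability (measurableTypeR R) R) (f : R -> R)
    (g : S * measurableTypeR R -> \bar R) :
  is_density_of f F ->
  (forall A B, measurable A -> measurable B ->
    P (h @^-1` A `&` Z @^-1` B) = P (h @^-1` A) * F B)%E ->
  measurable_fun setT g -> (forall p, (0 <= g p)%E) ->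
  (\int[P]_w g (h w, Z w) =
   \int[P]_w \int[lebesgue_measure]_s (g (h w, s) * (f s)%:E))%E.
Proof.
move=> Ff hZ mg g0.
have mZ : measurable_fun setT (Z : Omega -> measurableTypeR R).
  exact: (measurable_funP Z).
have mhZ : measurable_fun setT (fun w => (h w, Z w : measurableTypeR R)).
  exact: measurable_fun_pair.
pose hZ' : {mfun Omega >-> (S * measurableTypeR R)%type} :=
  HB.pack (fun w => (h w, Z w)) (isMeasurableFun.Build _ _ _ _ _ mhZ).
transitivity (\int[distribution P hZ']_p g p)%E.
  by rewrite ge0_integral_distribution.
rewrite (eq_measure_integral (distribution P h \x F)%E); last first.
  move=> A mA _; apply/esym.
  by apply: product_measure_unique => // B C mB mC; rewrite -hZ.
rewrite fubini_tonelli1// ge0_integral_distribution; last 2 first.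
- exact: measurable_fun_fubini_tonelli_F.
- by move=> s; apply: integral_ge0.
apply: eq_integral => w _; rewrite /= /fubini_F.
by rewrite (integral_density _ _ _ Ff)//; exact: measurableT_comp.
Qed.

End independent_pair.

Section sigma_before_theory.
Context {d d' : measure_display} {Omega : measurableType d}
  {U : measurableType d'}.
Implicit Types Z : nat -> Omega -> U.

Lemma sigma_before_sigma_algebra Z i : sigma_algebra setT (sigma_before Z i).
Proof. exact: smallest_sigma_algebra. Qed.

Lemma sigma_before_preimage Z i j B : (j < i)%N -> measurable B ->
  sigma_before Z i (Z j @^-1` B).
Proof.
move=> ji mB; apply: sub_sigma_algebra; exists j => //.
by exists B => //; rewrite setTI.
Qed.

Lemma sigma_before_sub Z i (M : set_system Omega) : sigma_algebra setT M ->
  (forall j B, (j < i)%N -> measurable B -> M (Z j @^-1` B)) ->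
  sigma_before Z i `<=` M.
Proof.
move=> sM ZM; apply: smallest_sub => //.
by move=> _ [j /= ji] [B mB <-]; rewrite setTI; exact: ZM.
Qed.

Lemma sigma_before_mono Z i k : (i <= k)%N ->
  sigma_before Z i `<=` sigma_before Z k.
Proof.
move=> ik; apply: sigma_before_sub; first exact: sigma_before_sigma_algebra.
by move=> j B ji mB; apply: sigma_before_preimage => //; exact: leq_trans ik.
Qed.

Lemma eq_sigma_before Z Z' i : (forall j, (j < i)%N -> Z j = Z' j) ->
  sigma_before Z i = sigma_before Z' i.
Proof.
move=> ZZ'; congr (<<s _ >>); apply: eq_bigcupr => j /= ji.
by rewrite ZZ'.
Qed.

Lemma sigma_before_measurable Z i :
  (forall j, (j < i)%N -> measurable_fun setT (Z j)) ->
  sigma_before Z i `<=` measurable.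
Proof.
move=> mZ; apply: sigma_before_sub; first exact: sigma_algebra_measurable.
by move=> j B ji mB; rewrite -[X in measurable X]setTI; exact: mZ.
Qed.

End sigma_before_theory.

Section past_independent.
Context {R : realType} {d : measure_display} {Omega : measurableType d}.
Variables (P : probability Omega R) (X Y : nat -> {mfun Omega >-> R}).

Let index (k : nat + nat) : nat := match k with inl i => i | inr i => i end.

Let cylinder i (D : nat + nat -> set R) : set Omega :=
  [set w | forall k, (index k < i)%N -> D k (all_payoffs X Y k w)].

Let cylinders i : set_system Omega :=
  [set A | exists2 D, (forall k, measurable (D k)) & A = cylinder i D].

Let indices i := [seq inl j | j <- iota 0 i] ++ [seq inr j | j <- iota 0 i].

Let mem_indices i k : (k \in indices i) = (index k < i)%N.
Proof.
rewrite mem_cat; case: k => j /=.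
  rewrite mem_map; last by move=> ? ? [].
  rewrite mem_iota add0n leq0n /= [X in _ || X](_ : _ = false) ?orbF//.
  by apply/negP => /mapP[].
rewrite [X in X || _](_ : _ = false)/=; last by apply/negP => /mapP[].
by rewrite mem_map ?mem_iota// => ? ? [].
Qed.

Let uniq_indices i : uniq (indices i).
Proof.
rewrite cat_uniq !map_inj_uniq ?iota_uniq ?andbT/=; try by move=> ? ? [].
by apply/hasPn => _ /mapP[j _ ->]; apply/negP => /mapP[].
Qed.

Let cylinderE i D : cylinder i D =
  \big[setI/setT]_(k <- indices i) (all_payoffs X Y k @^-1` D k).
Proof.
rewrite -bigcap_seq; apply/seteqP; split => w.
  by move=> Dw k /=; rewrite mem_indices => /Dw.
by move=> Dw k ki; apply: Dw; rewrite /= mem_indices.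
Qed.

Lemma past_independent i c A B : mutually_independent P (all_payoffs X Y) ->
  (i <= match c with inl j => j | inr j => j end)%N ->
  sigma_before (fun j w => (X j w, Y j w)) i A -> measurable B ->
  (P (A `&` all_payoffs X Y c @^-1` B) = P A * P (all_payoffs X Y c @^-1` B))%E.
Proof.
move=> hP ic iA mB; set C := all_payoffs X Y c @^-1` B.
have mC : measurable C by rewrite -[C]setTI; exact: measurable_funP.
pose m2 : {measure set Omega -> \bar R} :=
  mscale (NngNum (fine_ge0 (measure_ge0 P C))) P.
have m2E E : (m2 E = P E * P C)%E.
  rewrite /m2 /= /mscale/= muleC fineK//; exact: fin_num_measure.
rewrite -m2E -[LHS]/(mrestr P mC A).
have Gm : [set E | cylinders i E /\ E `<=` setT] `<=` measurable.
  move=> _ [[D mD ->] _]; rewrite cylinderE.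
  apply: bigsetI_measurable => k _.
  by rewrite -[X in measurable X]setTI; exact: measurable_funP.
have := @g_sigma_algebra_measure_unique_trace _ _ _ (cylinders i) setT
  measurableT Gm _ (mrestr P mC) m2.
apply.
- move=> E E' [[D mD ->] _] [[D' mD' ->] _]; split=> //.
  exists (fun k => D k `&` D' k); first by move=> k; exact: measurableI.
  apply/seteqP; split => w; first by move=> [Dw D'w] k ki; split; auto.
  by move=> DDw; split=> k ki; have [] := DDw _ ki.
- by rewrite m2E /= /mrestr setTI probability_setT mul1e.
- move=> _ [[D mD ->] _]; rewrite m2E /= /mrestr cylinderE.
  pose D' k := if k == c then B else D k.
  have cI : c \notin indices i by rewrite mem_indices -leqNgt.
  have mD' k : measurable (D' k) by rewrite /D'; case: ifP.
  have := hP (c :: indices i) D'.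
  rewrite /= cI uniq_indices => /(_ isT mD').
  have D'E (T : Type) op (idx : T) (f : set Omega -> T) :
      \big[op/idx]_(k <- indices i) f (all_payoffs X Y k @^-1` D' k) =
      \big[op/idx]_(k <- indices i) f (all_payoffs X Y k @^-1` D k).
    apply: eq_big_seq => k ki; rewrite /D' ifN//.
    by apply: contra cI => /eqP <-.
  rewrite !big_cons (D'E _ _ _ idfun) D'E -hP// {1 2}/D' eqxx setIC => ->.
  by rewrite muleC.
- by rewrite /= /mrestr setTI (le_lt_trans (probability_le1 _ _))// ltry.
- by [].
suff : sigma_before (fun j w => (X j w, Y j w)) i `<=` <<s cylinders i >>.
  rewrite [X in <<s X >>](_ : _ = [set E | cylinders i E /\ E `<=` setT]).
    exact.
  by apply/seteqP; split => E; [split|case].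
apply: sigma_before_sub; first exact: smallest_sigma_algebra.
move=> j D ji mD.
have mcoord k : (index k < i)%N ->
    measurable_fun (setT : set (g_sigma_algebraType (cylinders i)))
      (all_payoffs X Y k).
  move=> ki _ E mE; rewrite setTI; apply: sub_sigma_algebra.
  exists (fun k' => if k' == k then E else setT); first by move=> k'; case: ifP.
  apply/seteqP; split => w; first by move=> Ew k' _; case: eqP => [->|].
  by move=> /(_ _ ki); rewrite eqxx.
have := measurable_fun_pair (mcoord (inl j) ji) (mcoord (inr j) ji).
by move=> /(_ measurableT _ mD); rewrite setTI.
Qed.

End past_independent.

Section disintegration.
Context {d d' : measure_display} {Omega : measurableType d}
  {S : measurableType d'} {R : realType} (m : {measure set Omega -> \bar R}).
Local Notation mu := (@lebesgue_measure R).
Variables (h : Omega -> S) (z : Omega -> R) (kern : S * R -> R).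
Hypotheses (mh : measurable_fun setT h) (mkern : measurable_fun setT kern).
Hypothesis kern_ge0 : forall p, 0 <= kern p.
Hypothesis mz : measurable_fun setT z.
Hypothesis disintegration : forall g : S * R -> \bar R,
  measurable_fun setT g -> (forall p, (0 <= g p)%E) ->
  (\int[m]_w g (h w, z w) = \int[m]_w \int[mu]_s (g (h w, s) * (kern (h w, s))%:E))%E.

Lemma integral_disintegration (g : S * R -> R) : measurable_fun setT g ->
  m.-integrable setT (fun w => (g (h w, z w))%:E) ->
  m.-integrable setT (fun w => \int[mu]_s (g (h w, s) * kern (h w, s))%:E)%E /\
  (\int[m]_w (g (h w, z w))%:E =
   \int[m]_w \int[mu]_s (g (h w, s) * kern (h w, s))%:E)%E.
Proof.
move=> mg ig; pose G := EFin \o g.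
have mG : measurable_fun setT G by exact/measurable_EFinP.
pose u (H : S * R -> \bar R) w := (\int[mu]_s (H (h w, s) * (kern (h w, s))%:E))%E.
have mu_ H : measurable_fun setT H -> measurable_fun setT (u H).
  move=> mH; apply: (measurableT_comp (f := fun t : S =>
    (\int[mu]_s (H (t, s) * (kern (t, s))%:E))%E) _ mh).
  apply: (measurable_integral_param mu (fun p => H p * (kern p)%:E)%E).
  by apply: emeasurable_funM => //; exact/measurable_EFinP.
have mGp := measurable_funepos mG.
have mGn := measurable_funeneg mG.
have ip : (\int[m]_w G^\+ (h w, z w) = \int[m]_w u G^\+ w)%E.
  exact: disintegration.
have in_ : (\int[m]_w G^\- (h w, z w) = \int[m]_w u G^\- w)%E.
  exact: disintegration.
have u_ge0 H w : (forall p, 0 <= H p)%E -> (0 <= u H w)%E.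
  by move=> H0; apply: integral_ge0 => s _; rewrite mule_ge0 ?lee_fin.
have iu H : measurable_fun setT H -> (forall p, 0 <= H p)%E ->
    m.-integrable setT (fun w => H (h w, z w)) -> m.-integrable setT (u H).
  move=> mH H0 /integrableP[_ iH]; apply/integrableP; split; first exact: mu_.
  under eq_integral do rewrite gee0_abs ?u_ge0//.
  rewrite -(disintegration _ mH H0).
  by rewrite (eq_integral (fun w : Omega => `|H (h w, z w)|%E))// => w _; rewrite gee0_abs.
have iup : m.-integrable setT (u G^\+)%E.
  apply: iu => //; have := integrable_funepos measurableT ig.
  by congr (integrable _ _ _); apply/funext => w; rewrite !funeposE.
have iun : m.-integrable setT (u G^\-)%E.
  apply: iu => //; have := integrable_funeneg measurableT ig.
  by congr (integrable _ _ _); apply/funext => w; rewrite !funenegE.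
have uE : (fun w => \int[mu]_s (g (h w, s) * kern (h w, s))%:E)%E =
    (u G^\+ \- u G^\-)%E.
  apply/funext => w; rewrite integralE /u; congr (_ - _)%E.
    apply: eq_integral => s _; rewrite !funeposE EFinM.
    by rewrite maxe_pMl ?mul0e// lee_fin.
  apply: eq_integral => s _; rewrite !funenegE EFinM.
  by rewrite -mulNe maxe_pMl ?mul0e// lee_fin.
rewrite uE; split; first exact: integrableB.
rewrite integralB// -ip -in_ [LHS]integralE; congr (_ - _)%E.
  by apply: eq_integral => w _; rewrite !funeposE.
by apply: eq_integral => w _; rewrite !funenegE.
Qed.

End disintegration.

Definition past_measurable {R : realType} {d d' : measure_display}
    {Omega : measurableType d} {S : measurableType d'}
    (X Y : nat -> {mfun Omega >-> R}) (i : nat) (h : Omega -> S) : Prop :=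
  forall A, measurable A ->
    sigma_before (fun j w => (X j w, Y j w)) i (h @^-1` A).

Section one_hypothesis.
Context {R : realType} {d d' : measure_display} {Omega : measurableType d}
  {S : measurableType d'}.
Local Notation mu := (@lebesgue_measure R).
Variables (P : probability Omega R) (X Y : nat -> {mfun Omega >-> R}).

Lemma past_measurable_fun i (h : Omega -> S) :
  past_measurable X Y i h -> measurable_fun setT h.
Proof.
move=> hh _ A mA; rewrite setTI; have := hh A mA.
apply: sigma_before_measurable => j _; exact: measurable_fun_pair.
Qed.

Lemma integral_next_arm i c (F : probability (measurableTypeR R) R) f
    (h : Omega -> S) (g : S * R -> \bar R) :
  mutually_independent P (all_payoffs X Y) ->
  (i <= match c with inl j => j | inr j => j end)%N ->
  is_density_of f F -> has_law P (all_payoffs X Y c) F ->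
  past_measurable X Y i h ->
  measurable_fun setT g -> (forall p, (0 <= g p)%E) ->
  (\int[P]_w g (h w, all_payoffs X Y c w) =
   \int[P]_w \int[mu]_s (g (h w, s) * (f s)%:E))%E.
Proof.
move=> hP ic Ff cF hh mg g0; have mh := past_measurable_fun _ _ hh.
pose h' : {mfun Omega >-> S} :=
  HB.pack h (isMeasurableFun.Build _ _ _ _ _ mh).
apply: (integral_independent_pair P h' (all_payoffs X Y c) F f g Ff _ mg g0).
move=> A B mA mB; rewrite -cF//.
by apply: past_independent hP ic _ mB; exact: hh.
Qed.

Lemma integral_next_arm_integrable i c (F : probability (measurableTypeR R) R) f
    (h : Omega -> S) (g : S * R -> R) :
  mutually_independent P (all_payoffs X Y) ->
  (i <= match c with inl j => j | inr j => j end)%N ->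
  is_density_of f F -> has_law P (all_payoffs X Y c) F ->
  past_measurable X Y i h -> measurable_fun setT g ->
  P.-integrable setT (fun w => (g (h w, all_payoffs X Y c w))%:E) ->
  P.-integrable setT (fun w => \int[mu]_s (g (h w, s) * f s)%:E)%E /\
  (\int[P]_w (g (h w, all_payoffs X Y c w))%:E =
   \int[P]_w \int[mu]_s (g (h w, s) * f s)%:E)%E.
Proof.
move=> hP ic Ff cF hh mg ig; have [mf f0 _] := Ff.
apply: (integral_disintegration P h (all_payoffs X Y c) (fun q => f q.2)) => //.
- exact: past_measurable_fun hh.
- exact: measurableT_comp.
by move=> g' mg' g'0; exact: integral_next_arm hP ic Ff cF hh mg' g'0.
Qed.

Variables (FX FY : probability (measurableTypeR R) R) (fX fY : R -> R).
Hypotheses (dX : is_density_of fX FX) (dY : is_density_of fY FY).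
Hypotheses (lX : forall i, has_law P (X i) FX) (lY : forall i, has_law P (Y i) FY).
Hypothesis hP : mutually_independent P (all_payoffs X Y).

Lemma integral_next_payoff i (h : Omega -> S) (b : S -> bool)
    (g : S * R -> \bar R) :
  past_measurable X Y i h -> measurable_fun setT b ->
  measurable_fun setT g -> (forall p, (0 <= g p)%E) ->
  (\int[P]_w g (h w, if b (h w) then X i w else Y i w) =
   \int[P]_w \int[mu]_s (g (h w, s) * (if b (h w) then fX s else fY s)%:E))%E.
Proof.
move=> hh mb mg g0; have mh := past_measurable_fun _ _ hh.
have [mfX fX0 _] := dX; have [mfY fY0 _] := dY.
have mb1 : measurable_fun setT (fun p : S * R => b p.1) by exact: measurableT_comp.
pose gX (p : S * R) := if b p.1 then g p else 0%E.
pose gY (p : S * R) := if b p.1 then 0%E else g p.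
have mgX : measurable_fun setT gX by exact: measurable_fun_ifT.
have mgY : measurable_fun setT gY by exact: measurable_fun_ifT.
have gX0 p : (0 <= gX p)%E by rewrite /gX; case: ifP.
have gY0 p : (0 <= gY p)%E by rewrite /gY; case: ifP.
have mgZ (H : S * R -> \bar R) (Z : {mfun Omega >-> R}) :
    measurable_fun setT H -> measurable_fun setT (fun w => H (h w, Z w)).
  by move=> mH; apply: (measurableT_comp mH); exact: measurable_fun_pair.
have mI (H : S * R -> \bar R) (f : R -> R) : measurable_fun setT f ->
    measurable_fun setT H ->
    measurable_fun setT (fun w => \int[mu]_s (H (h w, s) * (f s)%:E))%E.
  move=> mf mH; apply: (measurableT_comp (f := fun t : S =>
    (\int[mu]_s (H (t, s) * (f s)%:E))%E) _ mh).
  apply: (measurable_integral_param mu (fun p => H p * (f p.2)%:E)%E).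
  apply: emeasurable_funM => //; apply/measurable_EFinP.
  exact: measurableT_comp.
transitivity (\int[P]_w (gX (h w, X i w) + gY (h w, Y i w)))%E.
  apply: eq_integral => w _; rewrite /gX /gY /=.
  by case: (b (h w)); rewrite ?adde0 ?add0e.
rewrite ge0_integralD//; [|exact: mgZ|exact: mgZ].
rewrite (integral_next_arm i (inl i) FX fX h gX)//; last exact: lX.
rewrite (integral_next_arm i (inr i) FY fY h gY)//; last exact: lY.
rewrite -ge0_integralD//; last 4 first.
- by move=> w _; apply: integral_ge0 => s _; rewrite mule_ge0 ?lee_fin.
- exact: mI.
- by move=> w _; apply: integral_ge0 => s _; rewrite mule_ge0 ?lee_fin.
- exact: mI.
apply: eq_integral => w _; rewrite /gX /gY/=.
case: (b (h w)).
  rewrite [X in (_ + X)%E]integral0_eq ?adde0// => s _; exact: mul0e.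
rewrite [X in (X + _)%E]integral0_eq ?add0e// => s _; exact: mul0e.
Qed.

End one_hypothesis.

Section adapted.
Context {d d' d'' : measure_display} {Omega : measurableType d}
  {U : measurableType d'} {S : measurableType d''}.

Local Notation sigma_beforeType Z i := (g_sigma_algebraType
  (\bigcup_(j in [set j : nat | (j < i)%N])
    preimage_set_system setT (Z j) (@measurable _ U))).

Lemma adaptedP (Z : nat -> Omega -> U) i (h : Omega -> S) :
  measurable_fun (setT : set (sigma_beforeType Z i)) h <->
  (forall A, measurable A -> sigma_before Z i (h @^-1` A)).
Proof.
split=> [mh A mA|hh _ A mA]; last by rewrite setTI; exact: hh.
by have := mh measurableT A mA; rewrite setTI.
Qed.

Lemma adapted_boolP (Z : nat -> Omega -> U) i (b : Omega -> bool) :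
  measurable_fun (setT : set (sigma_beforeType Z i)) b <->
  sigma_before Z i [set w | b w].
Proof.
split=> [mb|hb]; first by have := mb measurableT [set true] I; rewrite setTI.
by apply: (measurable_fun_bool true); rewrite setTI.
Qed.

Lemma measurable_sigma_before (Z : nat -> Omega -> U) i j : (j < i)%N ->
  measurable_fun (setT : set (sigma_beforeType Z i)) (Z j).
Proof.
move=> ji _ A mA; rewrite setTI; exact: sigma_before_preimage.
Qed.

Lemma measurable_sigma_beforeW (Z : nat -> Omega -> U) i k (h : Omega -> S) :
  (i <= k)%N ->
  measurable_fun (setT : set (sigma_beforeType Z i)) h ->
  measurable_fun (setT : set (sigma_beforeType Z k)) h.
Proof.
move=> ik /adaptedP hh; apply/adaptedP => A mA.
by apply: sigma_before_mono (hh A mA).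
Qed.

End adapted.

Notation sigma_beforeType Z i := (g_sigma_algebraType
  (\bigcup_(j in [set j : nat | (j < i)%N])
    preimage_set_system setT (Z j) measurable)).

Section strategies.
Context {R : realType} {d : measure_display} {Omega : measurableType d}.
Variables (X Y : nat -> {mfun Omega >-> R}).
Local Notation payoff := (payoff X Y).
Local Notation pairs := (fun j (w : Omega) => (X j w, Y j w)).
Implicit Types theta : nat -> Omega -> bool.

Lemma measurable_pairs_payoff theta i j : (j < i)%N ->
  sigma_before pairs j [set w | theta j w] ->
  measurable_fun (setT : set (sigma_beforeType pairs i)) (payoff theta j).
Proof.
move=> ji tj; have mp := measurable_sigma_before pairs i j ji.
apply: measurable_fun_ifT.
- by apply: (measurable_sigma_beforeW pairs j) (ltnW ji) _; exact/adapted_boolP.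
- exact: (measurableT_comp measurable_fst mp).
- exact: (measurableT_comp measurable_snd mp).
Qed.

Lemma measurable_pairs_total theta i :
  (forall j, (j < i)%N -> sigma_before pairs j [set w | theta j w]) ->
  measurable_fun (setT : set (sigma_beforeType pairs i)) (total_payoff X Y theta i).
Proof.
move=> ti; apply: measurable_sum => j; apply: measurable_pairs_payoff => //.
exact: ti.
Qed.

Lemma sigma_before_payoff_pairs theta i :
  (forall j, (j < i)%N -> sigma_before pairs j [set w | theta j w]) ->
  sigma_before (payoff theta) i `<=` sigma_before pairs i.
Proof.
move=> ti; apply: sigma_before_sub; first exact: sigma_before_sigma_algebra.
move=> j B ji mB.
have := measurable_pairs_payoff theta i j ji (ti j ji) measurableT B mB.
by rewrite setTI.
Qed.

Lemma strategyP n theta : strategy X Y n theta <->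
  forall i, (i < n)%N -> sigma_before (payoff theta) i [set w | theta i w].
Proof.
split=> [st i /st[]//|st]; elim/ltn_ind => i IH ilt; split; last exact: st.
apply: sigma_before_payoff_pairs (st i ilt) => j ji.
by have [] := IH j ji (ltn_trans ji ilt).
Qed.

Lemma eq_payoff_lt theta (c : Omega -> bool) i j : (j < i)%N ->
  payoff (fun j w => if (j < i)%N then theta j w else c w) j = payoff theta j.
Proof. by move=> ji; apply/funext => w; rewrite /Defs.payoff ji. Qed.

Lemma strategy_extend theta (c : Omega -> bool) i : strategy X Y i theta ->
  sigma_before (payoff theta) i [set w | c w] ->
  strategy X Y i.+1 (fun j w => if (j < i)%N then theta j w else c w).
Proof.
move=> /strategyP st hc; apply/strategyP => j; rewrite ltnS leq_eqVlt => ji.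
rewrite (eq_sigma_before _ (payoff theta)); last first.
  move=> k kj; apply: eq_payoff_lt; apply: (leq_trans kj).
  by case/predU1P: ji => [->//|/ltnW].
by case/predU1P: ji => [->|ji]; [under eq_set do rewrite ltnn|rewrite ji; exact: st].
Qed.

Lemma strategy_extend_const theta (b : bool) i : strategy X Y i theta ->
  strategy X Y i.+1 (fun j w => if (j < i)%N then theta j w else b).
Proof.
move=> st; apply: (strategy_extend _ (fun=> b)) => //.
by apply/adapted_boolP; exact: measurable_cst.
Qed.

Lemma total_payoff_extend theta (c : Omega -> bool) i w :
  total_payoff X Y (fun j w => if (j < i)%N then theta j w else c w) i.+1 w =
  total_payoff X Y theta i w + (if c w then X i w else Y i w).
Proof.
rewrite /total_payoff big_ord_recr /= {2}/Defs.payoff ltnn; congr (_ + _).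
by apply: eq_bigr => j _; rewrite eq_payoff_lt.
Qed.

End strategies.

Lemma measurable_inv {R : realType} : measurable_fun [set: R] (@GRing.inv R).
Proof.
have o0 : open [set x : R | x != 0] by exact: open_neq.
rewrite (_ : [set: R] = [set 0] `|` [set x | x != 0]); last first.
  by apply/seteqP; split=> x //= _; case: (eqVneq x 0); [left|right].
apply/measurable_funU => //; first exact: open_measurable.
split; first exact: measurable_fun_set1.
apply: open_continuous_measurable_fun => //.
by move=> x /set_mem /=; exact: inv_continuous.
Qed.

(** * Posterior probabilities *)

Section mixture.
Context {d : measure_display} {T : measurableType d} {R : realType}.
Variables (P1 P2 : {measure set T -> \bar R}) (a b : {nonneg R}).
Local Open Scope ereal_scope.

Definition mixture : {measure set T -> \bar R} :=
  measure_add (mscale a P1) (mscale b P2).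

Lemma ge0_integral_mixture (g : T -> \bar R) :
  measurable_fun setT g -> (forall w, 0 <= g w) ->
  \int[mixture]_w g w =
  (a%:num)%:E * \int[P1]_w g w + (b%:num)%:E * \int[P2]_w g w.
Proof.
by move=> mg g0; rewrite ge0_integral_measure_add// !ge0_integral_mscale.
Qed.

Lemma integrable_mixture (g : T -> \bar R) :
  P1.-integrable setT g -> P2.-integrable setT g -> mixture.-integrable setT g.
Proof.
move=> /integrableP[mg i1] /integrableP[_ i2]; apply/integrableP; split=> //.
rewrite ge0_integral_mixture//; last exact: measurableT_comp.
by rewrite lte_add_pinfty// lte_mul_pinfty// ?lee_fin.
Qed.

Lemma integral_mixture (g : T -> \bar R) :
  P1.-integrable setT g -> P2.-integrable setT g ->
  \int[mixture]_w g w =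
  (a%:num)%:E * \int[P1]_w g w + (b%:num)%:E * \int[P2]_w g w.
Proof.
move=> i1 i2; have mg := measurable_int _ i1.
rewrite integralE !ge0_integral_mixture//; last 2 first.
- exact: measurable_funeneg.
- exact: measurable_funepos.
rewrite [\int[P1]_w g w]integralE [\int[P2]_w g w]integralE.
have fp := integrable_fin_num measurableT (integrable_funepos measurableT _).
have fn := integrable_fin_num measurableT (integrable_funeneg measurableT _).
rewrite -(fineK (fp _ _ _ _ _ i1)) -(fineK (fn _ _ _ _ _ i1)).
rewrite -(fineK (fp _ _ _ _ _ i2)) -(fineK (fn _ _ _ _ _ i2)).
move: (fine (\int[P1]_w g^\+ w)) (fine (\int[P1]_w g^\- w))
  (fine (\int[P2]_w g^\+ w)) (fine (\int[P2]_w g^\- w)) => x x' y y'.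
transitivity (a%:num * (x - x') + b%:num * (y - y'))%:E => //.
transitivity (a%:num * x + b%:num * y - (a%:num * x' + b%:num * y'))%:E => //.
by congr EFin; ring.
Qed.

End mixture.

Lemma measurable_posterior_step {R : realType} {d : measure_display}
    {T : measurableType d} (f1 f2 : R -> R) (u z : T -> R) (c : T -> bool) :
  measurable_fun setT f1 -> measurable_fun setT f2 ->
  measurable_fun setT u -> measurable_fun setT z -> measurable_fun setT c ->
  measurable_fun setT (fun t => posterior_step f1 f2 (u t) (c t) (z t)).
Proof.
move=> mf1 mf2 mu mz mc.
have mstep (f g : R -> R) : measurable_fun setT f -> measurable_fun setT g ->
    measurable_fun setT (fun t =>
      u t * f (z t) / (u t * f (z t) + (1 - u t) * g (z t))).
  move=> mf mg; have muf : measurable_fun setT (fun t => u t * f (z t)).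
    by apply: measurable_funM => //; exact: measurableT_comp.
  apply: measurable_funM => //; apply: (measurableT_comp measurable_inv).
  apply: measurable_funD => //; apply: measurable_funM; first exact: measurable_funB.
  exact: measurableT_comp.
by apply: measurable_fun_ifT => //; exact: mstep.
Qed.

Definition arm_density {R : realType} (f1 f2 : R -> R) (c : bool) (s : R) : R :=
  if c then f1 s else f2 s.

Definition mixed_density {R : realType} {S : Type} (f1 f2 : R -> R)
    (p : S -> R) (c : S -> bool) (q : S * R) : R :=
  p q.1 * arm_density f1 f2 (c q.1) q.2 +
  (1 - p q.1) * arm_density f1 f2 (~~ c q.1) q.2.

Section posterior_history.
Context {R : realType} {d : measure_display} {Omega : measurableType d}.
Variables (P1 P2 : probability Omega R) (X Y : nat -> {mfun Omega >-> R}).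
Variables (F1 F2 : probability (measurableTypeR R) R) (f1 f2 : R -> R).
Hypothesis hmodel : bandit_model P1 P2 X Y F1 F2 f1 f2.
Variables (a b : {nonneg R}) (theta : nat -> Omega -> bool).
Hypothesis ab1 : a%:num + b%:num = 1.
Local Notation mu := (@lebesgue_measure R).
Local Notation mix := (mixture P1 P2 a b).

Local Notation arm := (arm_density f1 f2).

Let mf1 : measurable_fun [set: R] f1. Proof. by case: (density1 hmodel). Qed.
Let mf2 : measurable_fun [set: R] f2. Proof. by case: (density2 hmodel). Qed.
Let f1_ge0 s : 0 <= f1 s. Proof. by case: (density1 hmodel). Qed.
Let f2_ge0 s : 0 <= f2 s. Proof. by case: (density2 hmodel). Qed.

Let arm_density_ge0 c s : 0 <= arm c s.
Proof. by case: c. Qed.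

Let measurable_arm_density {d' : measure_display} {S : measurableType d'}
    (c : S -> bool) : measurable_fun setT c ->
  measurable_fun setT (fun p : S * R => arm (c p.1) p.2).
Proof.
by move=> mc; apply: measurable_fun_ifT; exact: measurableT_comp.
Qed.

(* The last two clauses say that the posterior is a density of [P1], restricted
   to the history, with respect to the mixture. *)
Record posterior_history {d' : measure_display} {S : measurableType d'}
    (i : nat) (h : Omega -> S) (p : S -> R) : Prop := PosteriorHistory {
  history_past : past_measurable X Y i h;
  history_payoff : forall j, (j < i)%N ->
    exists2 z : S -> R, measurable_fun setT z & payoff X Y theta j = z \o h;
  history_measurable : measurable_fun setT p;
  history_01 : forall s, 0 <= p s <= 1;
  history_posterior : posterior X Y f1 f2 a%:num theta i = p \o h;
  history_left : forall g : S -> \bar R,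
    measurable_fun setT g -> (forall s, (0 <= g s)%E) ->
    ((a%:num)%:E * \int[P1]_w g (h w) = \int[mix]_w ((p (h w))%:E * g (h w)))%E;
  history_right : forall g : S -> \bar R,
    measurable_fun setT g -> (forall s, (0 <= g s)%E) ->
    ((b%:num)%:E * \int[P2]_w g (h w) =
     \int[mix]_w ((1 - p (h w))%:E * g (h w)))%E }.

Arguments history_past {d' S i h p}.
Arguments history_payoff {d' S i h p}.
Arguments history_measurable {d' S i h p}.
Arguments history_01 {d' S i h p}.
Arguments history_posterior {d' S i h p}.
Arguments history_left {d' S i h p}.
Arguments history_right {d' S i h p}.

Lemma posterior_history0 : posterior_history 0 (fun=> tt) (fun=> a%:num).
Proof.
have a1 : 0 <= (a%:num : R) <= 1 by rewrite -ab1 lerDl !ge0.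
have cstE c : (0 <= c -> \int[mix]_w c = c)%E.
  move=> c0; rewrite ge0_integral_mixture// !integral_probability_cst.
  rewrite -ge0_muleDl ?lee_fin//.
  by rewrite -EFinD ab1 mul1e.
split=> //.
- by apply/adaptedP; exact: measurable_cst.
- move=> g _ g0; rewrite integral_probability_cst cstE//.
  by rewrite mule_ge0 ?lee_fin.
- move=> g _ g0; rewrite integral_probability_cst cstE//.
    by rewrite -ab1 addrC addKr.
  by rewrite mule_ge0 ?lee_fin// subr_ge0; case/andP: a1.
Qed.

Section step.
Context {d' : measure_display} {S : measurableType d'}.
Variables (i : nat) (h : Omega -> S) (p : S -> R) (c : S -> bool).
Hypothesis hist : posterior_history i h p.
Hypotheses (mc : measurable_fun setT c) (thetaE : theta i = c \o h).

Local Notation mixed := (mixed_density f1 f2 p c).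

Let p_ge0 s : 0 <= p s. Proof. by case/andP: (history_01 hist s). Qed.
Let p_le1 s : 0 <= 1 - p s.
Proof. by rewrite subr_ge0; case/andP: (history_01 hist s). Qed.

Let mp1 : measurable_fun setT (fun q : S * R => p q.1).
Proof. exact: (measurableT_comp (history_measurable hist)). Qed.

Lemma measurable_mixed_density : measurable_fun setT mixed.
Proof.
apply: measurable_funD; apply: measurable_funM => //.
- exact: measurable_arm_density.
- exact: measurable_funB.
- by apply: (measurable_arm_density (fun s => ~~ c s)); exact: measurable_neg.
Qed.

Lemma mixed_density_ge0 q : 0 <= mixed q.
Proof. by rewrite addr_ge0 ?mulr_ge0. Qed.

Lemma integral_payoff_P1 (g : S * R -> \bar R) :
  measurable_fun setT g -> (forall q, (0 <= g q)%E) ->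
  (\int[P1]_w g (h w, payoff X Y theta i w) =
   \int[P1]_w \int[mu]_s (g (h w, s) * (arm (c (h w)) s)%:E))%E.
Proof.
move=> mg g0.
rewrite -(integral_next_payoff P1 X Y F1 F2 f1 f2 (density1 hmodel)
  (density2 hmodel) (law_X_H1 hmodel) (law_Y_H1 hmodel) (indep_H1 hmodel) i)//.
- by apply: eq_integral => w _; rewrite /payoff thetaE.
- exact: history_past hist.
Qed.

Lemma integral_payoff_P2 (g : S * R -> \bar R) :
  measurable_fun setT g -> (forall q, (0 <= g q)%E) ->
  (\int[P2]_w g (h w, payoff X Y theta i w) =
   \int[P2]_w \int[mu]_s (g (h w, s) * (arm (~~ c (h w)) s)%:E))%E.
Proof.
move=> mg g0.
transitivity (\int[P2]_w \int[mu]_s (g (h w, s) *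
    (if c (h w) then f2 s else f1 s)%:E))%E.
  rewrite -(integral_next_payoff P2 X Y F2 F1 f2 f1 (density2 hmodel)
    (density1 hmodel) (law_X_H2 hmodel) (law_Y_H2 hmodel) (indep_H2 hmodel) i)//.
  - by apply: eq_integral => w _; rewrite /payoff thetaE.
  - exact: history_past hist.
by apply: eq_integral => w _; apply: eq_integral => s _; case: (c (h w)).
Qed.

Let measurable_arm_integral (g : S * R -> \bar R) (c' : S -> bool) :
  measurable_fun setT g -> measurable_fun setT c' ->
  measurable_fun setT
    (fun t => \int[mu]_s (g (t, s) * (arm (c' t) s)%:E))%E.
Proof.
move=> mg mc'; apply: (measurable_integral_param mu
  (fun q => g q * (arm (c' q.1) q.2)%:E)%E).
by apply: emeasurable_funM => //; apply/measurable_EFinP; exact: measurable_arm_density.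
Qed.

Let arm_integral_ge0 (g : S * R -> \bar R) (c' : S -> bool) t :
  (forall q, (0 <= g q)%E) ->
  (0 <= \int[mu]_s (g (t, s) * (arm (c' t) s)%:E))%E.
Proof. by move=> g0; apply: integral_ge0 => s _; rewrite mule_ge0 ?lee_fin. Qed.

Let mnc : measurable_fun setT (fun s => ~~ c s).
Proof. exact: measurable_neg. Qed.

Let mh : measurable_fun setT h.
Proof. exact: past_measurable_fun (history_past hist). Qed.

Let measurable_payoff : measurable_fun setT (payoff X Y theta i).
Proof.
apply: measurable_fun_ifT => //; rewrite thetaE; exact: measurableT_comp.
Qed.

Lemma mixture_disintegration (g : S * R -> \bar R) :
  measurable_fun setT g -> (forall q, (0 <= g q)%E) ->
  (\int[mix]_w g (h w, payoff X Y theta i w) =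
   \int[mix]_w \int[mu]_s (g (h w, s) * (mixed (h w, s))%:E))%E.
Proof.
move=> mg g0; rewrite ge0_integral_mixture//; last first.
  by apply: (measurableT_comp mg); exact: measurable_fun_pair.
rewrite integral_payoff_P1// integral_payoff_P2//.
have m1 := measurable_arm_integral g c mg mc.
have m2 := measurable_arm_integral g (fun s => ~~ c s) mg mnc.
rewrite (history_left hist _ m1); last by move=> s; exact: arm_integral_ge0.
rewrite (history_right hist _ m2); last first.
  by move=> s; exact: (arm_integral_ge0 g (fun s => ~~ c s)).
have mp := history_measurable hist.
rewrite -ge0_integralD//; last 4 first.
- by move=> w _; rewrite mule_ge0 ?lee_fin ?arm_integral_ge0.
- apply: (measurableT_comp (f := fun t : S => ((p t)%:E *
    \int[mu]_s (g (t, s) * (arm (c t) s)%:E))%E) _ mh).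
  by apply: emeasurable_funM => //; exact/measurable_EFinP.
- move=> w _; rewrite mule_ge0 ?lee_fin//.
  exact: (arm_integral_ge0 g (fun s => ~~ c s)).
- apply: (measurableT_comp (f := fun t : S => ((1 - p t)%:E *
    \int[mu]_s (g (t, s) * (arm (~~ c t) s)%:E))%E) _ mh).
  apply: emeasurable_funM => //; apply/measurable_EFinP.
  exact: measurable_funB.
apply: eq_integral => w _.
have mgw : measurable_fun setT (fun s => g (h w, s)) by exact: measurableT_comp.
have mf b' : measurable_fun setT (arm b') by case: b'.
rewrite -!ge0_integralZl ?lee_fin//; last 4 first.
- by apply: emeasurable_funM => //; apply/measurable_EFinP; exact: mf.
- by move=> s _; rewrite mule_ge0 ?lee_fin.
- by apply: emeasurable_funM => //; apply/measurable_EFinP; exact: mf.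
- by move=> s _; rewrite mule_ge0 ?lee_fin.
rewrite -ge0_integralD//; last 4 first.
- by move=> s _; rewrite !mule_ge0 ?lee_fin.
- apply: emeasurable_funM => //; apply: emeasurable_funM => //.
  apply/measurable_EFinP; exact: mf.
- by move=> s _; rewrite !mule_ge0 ?lee_fin.
- apply: emeasurable_funM => //; apply: emeasurable_funM => //.
  apply/measurable_EFinP; exact: mf.
apply: eq_integral => s _; rewrite /mixed_density/=.
rewrite muleCA [X in (_ + X)%E]muleCA -ge0_muleDr; last 2 first.
- by rewrite mule_ge0 ?lee_fin.
- by rewrite mule_ge0 ?lee_fin.
by rewrite -!EFinM.
Qed.

(* Where the mixed density vanishes so do both right-hand sides, which makes the
   convention x / 0 = 0 harmless. *)
Lemma posterior_step_mixed q :
  posterior_step f1 f2 (p q.1) (c q.1) q.2 * mixed q =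
    p q.1 * arm (c q.1) q.2 /\
  (1 - posterior_step f1 f2 (p q.1) (c q.1) q.2) * mixed q =
    (1 - p q.1) * arm (~~ c q.1) q.2.
Proof.
have pE : posterior_step f1 f2 (p q.1) (c q.1) q.2 =
    p q.1 * arm (c q.1) q.2 / mixed q.
  by rewrite /posterior_step /mixed_density /arm_density; case: (c q.1).
rewrite pE mulrBl mul1r; have [D0|D0] := eqVneq (mixed q) 0.
  have l0 := mulr_ge0 (p_ge0 q.1) (arm_density_ge0 (c q.1) q.2).
  have r0 := mulr_ge0 (p_le1 q.1) (arm_density_ge0 (~~ c q.1) q.2).
  move: (D0) => /eqP; rewrite paddr_eq0// => /andP[/eqP -> /eqP ->].
  by rewrite D0 !mulr0 subr0.
by rewrite divfK// /mixed_density addrC addKr.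
Qed.

Lemma posterior_step_01 q :
  0 <= posterior_step f1 f2 (p q.1) (c q.1) q.2 <= 1.
Proof.
have pE : posterior_step f1 f2 (p q.1) (c q.1) q.2 =
    p q.1 * arm (c q.1) q.2 / mixed q.
  by rewrite /posterior_step /mixed_density /arm_density; case: (c q.1).
have D_ge0 := mixed_density_ge0 q.
have l0 := mulr_ge0 (p_ge0 q.1) (arm_density_ge0 (c q.1) q.2).
have r0 := mulr_ge0 (p_le1 q.1) (arm_density_ge0 (~~ c q.1) q.2).
rewrite pE divr_ge0//=; have [D0|D0] := eqVneq (mixed q) 0.
  by rewrite D0 invr0 mulr0.
by rewrite ler_pdivrMr ?lt0r ?D0// mul1r /mixed_density lerDl.
Qed.

Lemma posterior_historyS :
  posterior_history i.+1 (fun w => (h w, payoff X Y theta i w))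
    (fun q => posterior_step f1 f2 (p q.1) (c q.1) q.2).
Proof.
have mstep : measurable_fun setT
    (fun q : S * R => posterior_step f1 f2 (p q.1) (c q.1) q.2).
  by apply: measurable_posterior_step => //; exact: measurableT_comp.
have marm c' : measurable_fun [set: R] (arm c') by case: c'.
split=> //.
- apply/adaptedP; apply: measurable_fun_pair.
    apply: (measurable_sigma_beforeW _ i) => //.
    by apply/adaptedP; exact: history_past hist.
  apply: measurable_pairs_payoff => //.
  rewrite (_ : [set w | _] = h @^-1` [set s | c s]); last by rewrite thetaE.
  apply: (history_past hist).
  by have := mc measurableT [set true] I; rewrite setTI.
- move=> j; rewrite ltnS leq_eqVlt => /predU1P[->|ji]; first by exists snd.
  have [z mz ->] := history_payoff hist j ji.
  by exists (z \o fst) => //; exact: measurableT_comp.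
- exact: posterior_step_01.
- by apply/funext => w /=; rewrite (history_posterior hist) thetaE.
- move=> g mg g0; have m1 := measurable_arm_integral g c mg mc.
  rewrite integral_payoff_P1// (history_left hist _ m1); last first.
    by move=> s; exact: arm_integral_ge0.
  rewrite [RHS](mixture_disintegration (fun q =>
    (posterior_step f1 f2 (p q.1) (c q.1) q.2)%:E * g q)%E); last 2 first.
  + by apply: emeasurable_funM => //; exact/measurable_EFinP.
  + by move=> q; rewrite mule_ge0// lee_fin; case/andP: (posterior_step_01 q).
  apply: eq_integral => w _.
  rewrite -ge0_integralZl ?lee_fin//; last 2 first.
  + apply: emeasurable_funM; first exact: measurableT_comp.
    by apply/measurable_EFinP; exact: marm.
  + by move=> s _; rewrite mule_ge0 ?lee_fin.
  apply: eq_integral => s _.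
  by rewrite muleCA [RHS]muleAC [RHS]muleC -!EFinM (posterior_step_mixed (_, _)).1.
- move=> g mg g0.
  have m2 := measurable_arm_integral g (fun s => ~~ c s) mg mnc.
  rewrite integral_payoff_P2// (history_right hist _ m2); last first.
    by move=> s; exact: (arm_integral_ge0 g (fun s => ~~ c s)).
  rewrite [RHS](mixture_disintegration (fun q =>
    (1 - posterior_step f1 f2 (p q.1) (c q.1) q.2)%:E * g q)%E); last 2 first.
  + by apply: emeasurable_funM => //; apply/measurable_EFinP; exact: measurable_funB.
  + move=> q; rewrite mule_ge0// lee_fin subr_ge0.
    by case/andP: (posterior_step_01 q).
  apply: eq_integral => w _.
  rewrite -ge0_integralZl ?lee_fin//; last 2 first.
  + apply: emeasurable_funM; first exact: measurableT_comp.
    by apply/measurable_EFinP; exact: marm.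
  + by move=> s _; rewrite mule_ge0 ?lee_fin.
  apply: eq_integral => s _.
  by rewrite muleCA [RHS]muleAC [RHS]muleC -!EFinM (posterior_step_mixed (_, _)).2.
Qed.

End step.

Lemma history_choice {d' : measure_display} {S : measurableType d'} i
    (h : Omega -> S) (p : S -> R) : posterior_history i h p ->
  sigma_before (payoff X Y theta) i [set w | theta i w] ->
  exists2 c : S -> bool, measurable_fun setT c & theta i = c \o h.
Proof.
move=> hist ti.
have [||B mB Bh] := @sigma_before_sub _ _ _ _ (payoff X Y theta) i
    (preimage_set_system setT h measurable) _ _ _ ti.
- exact/sigma_algebra_preimage/sigma_algebra_measurable.
- move=> j B ji mB; have [z mz ->] := history_payoff hist j ji.
  by exists (z @^-1` B); rewrite ?setTI// -[X in measurable X]setTI; exact: mz.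
exists (fun s => s \in B).
  apply: (measurable_fun_bool true); rewrite setTI.
  by rewrite (_ : _ @^-1` _ = B)//; apply/seteqP; split => s;
    [move/set_mem|move/mem_set].
apply/funext => w /=; apply/idP/idP.
  by move=> tw; apply/mem_set; have : [set w | theta i w] w by []; rewrite -Bh setTI.
by move=> /set_mem Bw; have : (setT `&` h @^-1` B) w by []; rewrite Bh.
Qed.

Lemma exists_history n i : strategy X Y n theta -> (i <= n)%N ->
  exists (d' : measure_display) (S : measurableType d') (h : Omega -> S)
    (p : S -> R), posterior_history i h p.
Proof.
move=> st; elim: i => [|i IH] ilt.
  by exists _, unit, (fun=> tt), (fun=> a%:num); exact: posterior_history0.
have [d' [S [h [p hist]]]] := IH (ltnW ilt).
have [c mc cE] := history_choice _ _ _ hist (st i ilt).2.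
by do 4 eexists; exact: posterior_historyS hist mc cE.
Qed.

End posterior_history.

Arguments history_past {R d Omega P1 P2 X Y f1 f2 a b theta d' S i h p}.
Arguments history_payoff {R d Omega P1 P2 X Y f1 f2 a b theta d' S i h p}.
Arguments history_measurable {R d Omega P1 P2 X Y f1 f2 a b theta d' S i h p}.
Arguments history_01 {R d Omega P1 P2 X Y f1 f2 a b theta d' S i h p}.
Arguments history_posterior {R d Omega P1 P2 X Y f1 f2 a b theta d' S i h p}.
Arguments history_left {R d Omega P1 P2 X Y f1 f2 a b theta d' S i h p}.
Arguments history_right {R d Omega P1 P2 X Y f1 f2 a b theta d' S i h p}.

Lemma envelopeC {R : realType} (f1 f2 phi : R -> R) k x :
  envelope f1 f2 phi k x = envelope f2 f1 phi k x.
Proof.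
elim: k x => [//|k IH] x /=; apply: eq_integral => s _.
by rewrite IH (addrC (f1 s)).
Qed.

Section envelope_total.
Context {R : realType} {d : measure_display} {Omega : measurableType d}.
Variables (P : probability Omega R) (X Y : nat -> {mfun Omega >-> R}).
Variables (FX FY : probability (measurableTypeR R) R) (fX fY phi : R -> R).
Hypotheses (dX : is_density_of fX FX) (dY : is_density_of fY FY).
Hypotheses (lX : forall i, has_law P (X i) FX) (lY : forall i, has_law P (Y i) FY).
Hypothesis hP : mutually_independent P (all_payoffs X Y).
Hypothesis mphi : measurable_fun [set: R] phi.
Hypothesis phi_int : forall n x theta, strategy X Y n theta ->
  P.-integrable setT (fun w => (phi (x + total_payoff X Y theta n w))%:E).
Local Notation mu := (@lebesgue_measure R).

Lemma envelope_total_fin k i theta x : strategy X Y i theta ->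
  (\int[P]_w envelope fX fY phi k (x + total_payoff X Y theta i w)%R < +oo)%E.
Proof.
have [[mfX fX0 _] [mfY fY0 _]] := (dX, dY).
have menv j := measurable_envelope fX fY phi mfX mfY mphi j.
have env0 := envelope_ge0 fX fY phi fX0 fY0.
elim: k i theta => [|k IH] i theta st.
  by have /integrableP[] := phi_int i x theta st.
have past_tot : past_measurable X Y i (total_payoff X Y theta i).
  by apply/adaptedP; apply: measurable_pairs_total => j ji; have [] := st j ji.
have mtot := past_measurable_fun _ _ _ _ past_tot.
pose g (q : R * R) := envelope fX fY phi k (x + (q.1 + q.2)).
have mg : measurable_fun setT g.
  apply: (measurableT_comp (menv k)); apply: measurable_funD => //.
  exact: measurable_funD.
have mgt f t : measurable_fun [set: R] f ->
    measurable_fun [set: R] (fun s => g (t, s) * (f s)%:E)%E.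
  move=> mf; apply: emeasurable_funM; last exact/measurable_EFinP.
  exact: measurableT_comp.
have mI f : measurable_fun [set: R] f -> measurable_fun setT
    (fun w => \int[mu]_s (g (total_payoff X Y theta i w, s) * (f s)%:E))%E.
  move=> mf; apply: (measurableT_comp (f := fun t : R =>
    (\int[mu]_s (g (t, s) * (f s)%:E))%E) _ mtot).
  apply: (measurable_integral_param mu (fun q => g q * (f q.2)%:E)%E).
  by apply: emeasurable_funM => //; apply/measurable_EFinP; exact: measurableT_comp.
have g0 q : (0 <= g q)%E by exact: env0.
have split_arm : (\int[P]_w envelope fX fY phi k.+1 (x + total_payoff X Y theta i w)%R =
    \int[P]_w g (total_payoff X Y theta i w, X i w) +
    \int[P]_w g (total_payoff X Y theta i w, Y i w))%E.
  rewrite (integral_next_arm P X Y i (inl i) FX fX _ g)//; last exact: lX.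
  rewrite (integral_next_arm P X Y i (inr i) FY fY _ g)//; last exact: lY.
  rewrite -ge0_integralD//; last 4 first.
  - by move=> w _; apply: integral_ge0 => s _; rewrite mule_ge0 ?lee_fin.
  - exact: mI.
  - by move=> w _; apply: integral_ge0 => s _; rewrite mule_ge0 ?lee_fin.
  - exact: mI.
  apply: eq_integral => w _; rewrite -ge0_integralD//; last 4 first.
  - by move=> s _; rewrite mule_ge0 ?lee_fin.
  - exact: mgt.
  - by move=> s _; rewrite mule_ge0 ?lee_fin.
  - exact: mgt.
  by apply: eq_integral => s _; rewrite /g/= addrA EFinD ge0_muleDr ?lee_fin.
have extend b := IH _ _ (strategy_extend_const X Y theta b i st).
rewrite split_arm lte_add_pinfty//.
- apply: le_lt_trans (extend true); rewrite le_eqVlt; apply/predU1P; left.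
  by apply: eq_integral => w _; rewrite (total_payoff_extend _ _ _ (fun=> true)).
- apply: le_lt_trans (extend false); rewrite le_eqVlt; apply/predU1P; left.
  by apply: eq_integral => w _; rewrite (total_payoff_extend _ _ _ (fun=> false)).
Qed.

Lemma envelope_fin k x : (envelope fX fY phi k x < +oo)%E.
Proof.
have st : strategy X Y 0 (fun _ _ => true) by [].
have [[mfX fX0 _] [mfY fY0 _]] := (dX, dY).
have := envelope_total_fin k 0 _ x st.
under eq_integral do rewrite /total_payoff big_ord0 addr0.
by rewrite integral_probability_cst.
Qed.

End envelope_total.

Section optimal_play.
Context {R : realType} {d : measure_display} {Omega : measurableType d}.
Variables (P1 P2 : probability Omega R) (X Y : nat -> {mfun Omega >-> R}).
Variables (F1 F2 : probability (measurableTypeR R) R) (f1 f2 phi : R -> R).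
Hypothesis hmodel : bandit_model P1 P2 X Y F1 F2 f1 f2.
Hypothesis hphi : suitable_utility P1 P2 X Y phi.
Local Notation mu := (@lebesgue_measure R).
Local Notation V := (bandit_value f1 f2 phi).
Local Notation next k := (next_value f1 f2 (V k)).

Let mf1 : measurable_fun [set: R] f1. Proof. by case: (density1 hmodel). Qed.
Let mf2 : measurable_fun [set: R] f2. Proof. by case: (density2 hmodel). Qed.
Let f1_ge0 s : 0 <= f1 s. Proof. by case: (density1 hmodel). Qed.
Let f2_ge0 s : 0 <= f2 s. Proof. by case: (density2 hmodel). Qed.
Let mphi := utility_measurable hphi.

Lemma envelope_total_fin1 k i theta x : strategy X Y i theta ->
  (\int[P1]_w envelope f1 f2 phi k (x + total_payoff X Y theta i w)%R < +oo)%E.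
Proof.
apply: (envelope_total_fin P1 X Y F1 F2 f1 f2 phi (density1 hmodel)
  (density2 hmodel) (law_X_H1 hmodel) (law_Y_H1 hmodel) (indep_H1 hmodel) mphi).
by move=> n y t st; have [] := utility_integrable hphi y st.
Qed.

Lemma envelope_total_fin2 k i theta x : strategy X Y i theta ->
  (\int[P2]_w envelope f1 f2 phi k (x + total_payoff X Y theta i w)%R < +oo)%E.
Proof.
under eq_integral do rewrite envelopeC.
apply: (envelope_total_fin P2 X Y F2 F1 f2 f1 phi (density2 hmodel)
  (density1 hmodel) (law_X_H2 hmodel) (law_Y_H2 hmodel) (indep_H2 hmodel) mphi).
by move=> n y t st; have [] := utility_integrable hphi y st.
Qed.

Lemma model_envelope_fin k x : (envelope f1 f2 phi k x < +oo)%E.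
Proof.
apply: (envelope_fin P1 X Y F1 F2 f1 f2 phi (density1 hmodel)
  (density2 hmodel) (law_X_H1 hmodel) (law_Y_H1 hmodel) (indep_H1 hmodel) mphi).
by move=> n y t st; have [] := utility_integrable hphi y st.
Qed.

Let fin := model_envelope_fin.
Let mV k := (enveloped_value f1 f2 phi mf1 mf2 f1_ge0 f2_ge0 mphi fin k).

Variables (a b : {nonneg R}).
Hypothesis ab1 : a%:num + b%:num = 1.
Local Notation mix := (mixture P1 P2 a b).
Local Notation xi theta i := (posterior X Y f1 f2 a%:num theta i).

Section play.
Variables (theta : nat -> Omega -> bool) (n : nat) (x : R).
Hypothesis st : strategy X Y n theta.

Let fund i w : R := x + total_payoff X Y theta i w.

Let stle i : (i <= n)%N -> strategy X Y i theta.
Proof. by move=> ilt j ji; apply: st; exact: leq_trans ilt. Qed.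

Let mtotal i : (i <= n)%N -> measurable_fun setT (total_payoff X Y theta i).
Proof.
move=> ilt; apply: (past_measurable_fun X Y i); apply/adaptedP.
by apply: measurable_pairs_total => j ji; have [] := stle i ilt j ji.
Qed.

Lemma posterior_01 i w : (i <= n)%N -> 0 <= xi theta i w <= 1.
Proof.
move=> ilt; have [d' [S [h [p hist]]]] :=
  exists_history P1 P2 X Y F1 F2 f1 f2 hmodel a b theta ab1 n i st ilt.
rewrite (history_posterior hist).
exact: (history_01 hist).
Qed.

Lemma measurable_posterior i : (i <= n)%N -> measurable_fun setT (xi theta i).
Proof.
move=> ilt; have [d' [S [h [p hist]]]] :=
  exists_history P1 P2 X Y F1 F2 f1 f2 hmodel a b theta ab1 n i st ilt.
rewrite (history_posterior hist).
apply: (measurableT_comp (history_measurable hist)).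
exact: past_measurable_fun (history_past hist).
Qed.

Lemma integrable_value k i : (i <= n)%N ->
  mix.-integrable setT (fun w => (V k (xi theta i w) (1 - xi theta i w) (fund i w))%:E).
Proof.
move=> ilt; have [mVk [C C0 hC]] := mV k; have mxi := measurable_posterior i ilt.
have mfund : measurable_fun setT (fund i).
  by apply: measurable_funD => //; exact: mtotal.
have menv : measurable_fun setT (fun w => envelope f1 f2 phi k (fund i w)).
  exact: (measurableT_comp (measurable_envelope f1 f2 phi mf1 mf2 mphi k)).
have bound (P : probability Omega R) :
    (\int[P]_w envelope f1 f2 phi k (fund i w) < +oo)%E ->
    P.-integrable setT
      (fun w => (V k (xi theta i w) (1 - xi theta i w) (fund i w))%:E).
  move=> envoo; apply/integrableP; split.
    apply/measurable_EFinP; apply: measurable_uncurry3 => //.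
    exact: measurable_funB.
  apply: (@le_lt_trans _ _ (\int[P]_w (C%:E * envelope f1 f2 phi k (fund i w)))%E).
    apply: ge0_le_integral => //.
    - apply/measurable_EFinP; apply: measurableT_comp => //.
      by apply: measurable_uncurry3 => //; exact: measurable_funB.
    - exact: measurable_funeM.
    move=> w _; have /andP[xi0 xi1] := posterior_01 i w ilt.
    have := hC (xi theta i w) (1 - xi theta i w) (fund i w) xi0.
    by rewrite subr_ge0 (addrC (xi theta i w)) subrK mulr1; exact.
  rewrite ge0_integralZl//; last by move=> w _; exact: envelope_ge0.
  by rewrite lte_mul_pinfty.
apply: integrable_mixture; apply: bound.
- by apply: envelope_total_fin1; exact: stle.
- by apply: envelope_total_fin2; exact: stle.
Qed.

Lemma history_total {d' : measure_display} {S : measurableType d'} i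
    (h : Omega -> S) (p : S -> R) :
  posterior_history P1 P2 X Y f1 f2 a b theta i h p ->
  exists2 t : S -> R, measurable_fun setT t & total_payoff X Y theta i = t \o h.
Proof.
move=> hist; suff: forall j, (j <= i)%N -> exists2 t : S -> R,
    measurable_fun setT t & total_payoff X Y theta j = t \o h by exact.
elim=> [_|j IH ji].
  by exists (fun=> 0) => //; apply/funext => w; rewrite /total_payoff big_ord0.
have [t mt tE] := IH (ltnW ji).
have [z mz zE] := history_payoff hist j ji.
exists (fun s => t s + z s); first exact: measurable_funD.
apply/funext => w; rewrite /total_payoff big_ord_recr/=.
by rewrite -/(total_payoff X Y theta j w) tE zE.
Qed.

Let branch k i w : R :=
  if theta i w then next k (xi theta i w) (1 - xi theta i w) (fund i w)
  else next k (1 - xi theta i w) (xi theta i w) (fund i w).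

Lemma value_step k i : (i < n)%N ->
  mix.-integrable setT (fun w => (branch k i w)%:E) /\
  (\int[mix]_w (V k (xi theta i.+1 w) (1 - xi theta i.+1 w) (fund i.+1 w))%:E =
   \int[mix]_w (branch k i w)%:E)%E.
Proof.
move=> ilt; have [d' [S [h [p hist]]]] :=
  exists_history P1 P2 X Y F1 F2 f1 f2 hmodel a b theta ab1 n i st (ltnW ilt).
have [c mc cE] := history_choice _ _ _ _ _ _ _ _ _ _ _ _ hist (st i ilt).2.
have [t mt tE] := history_total _ _ _ hist.
have xiE := history_posterior hist.
have p01 := history_01 hist.
pose step (q : S * R) := posterior_step f1 f2 (p q.1) (c q.1) q.2.
pose g (q : S * R) := V k (step q) (1 - step q) (x + (t q.1 + q.2)).
have gE w : V k (xi theta i.+1 w) (1 - xi theta i.+1 w) (fund i.+1 w) =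
    g (h w, payoff X Y theta i w).
  rewrite /g /step /fund /total_payoff big_ord_recr/=.
  by rewrite -/(total_payoff X Y theta i w) tE xiE cE.
have mstep : measurable_fun setT step.
  have mp := history_measurable hist.
  by apply: measurable_posterior_step => //; exact: measurableT_comp.
have mg : measurable_fun setT g.
  apply: measurable_uncurry3 => //; first by case: (mV k).
    exact: measurable_funB.
  apply: measurable_funD => //; apply: measurable_funD => //.
  exact: measurableT_comp.
have mh := past_measurable_fun _ _ _ _ (history_past hist).
have mpayoff : measurable_fun setT (payoff X Y theta i).
  by apply: measurable_fun_ifT => //; rewrite cE; exact: measurableT_comp.
have mdens := measurable_mixed_density _ _ _ _ _ _ _ _ hmodel _ _ _ _ _ _ _ hist mc.
have dens0 := mixed_density_ge0 _ _ _ _ _ _ _ _ hmodel _ _ _ _ _ _ c hist.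
have disint := mixture_disintegration _ _ _ _ _ _ _ _ hmodel _ _ _ _ _ _ _ hist mc cE.
have stepE := posterior_step_mixed _ _ _ _ _ _ _ _ hmodel _ _ _ _ _ _ c hist.
have step01 := posterior_step_01 _ _ _ _ _ _ _ _ hmodel _ _ _ _ _ _ c hist.
under eq_integral do rewrite gE.
have ig : mix.-integrable setT (fun w => (g (h w, payoff X Y theta i w))%:E).
  have := integrable_value k i.+1 ilt; congr (integrable _ _ _).
  by apply/funext => w; rewrite gE.
have [] := integral_disintegration mix h (payoff X Y theta i) _ mh mdens
  dens0 disint g mg ig.
rewrite (_ : (fun w => \int[mu]_s _)%E = (fun w => (branch k i w)%:E)) => [//|].
apply/funext => w; have /andP[p0 p1] := p01 (h w).
have p1' : 0 <= 1 - p (h w) by rewrite subr_ge0.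
rewrite /branch xiE cE /= /fund tE.
transitivity (\int[mu]_s (V k (p (h w) * arm_density f1 f2 (c (h w)) s)
    ((1 - p (h w)) * arm_density f1 f2 (~~ c (h w)) s)
    (x + (t (h w) + s)))%:E)%E.
  apply: eq_integral => s _; congr EFin.
  have [e1 e2] := stepE (h w, s); have /andP[s0 s1] := step01 (h w, s).
  rewrite -e1 -e2 /g /step/= mulrC.
  rewrite -(bandit_value_homogeneous _ _ _ mf1 mf2 f1_ge0 f2_ge0 mphi fin)//.
  - by congr (V k _ _ _); rewrite mulrC.
  - by rewrite subr_ge0.
case: (c (h w)) => /=; rewrite (EFin_next_value _ _ _ mf1 mf2 f1_ge0 f2_ge0 mphi fin)//.
  by apply: eq_integral => s _; rewrite addrA.
by apply: eq_integral => s _; rewrite bandit_valueC addrA.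
Qed.

Lemma branch_le_value k i w :
  branch k i w <= V k.+1 (xi theta i w) (1 - xi theta i w) (fund i w).
Proof. by rewrite bandit_valueS /branch le_max; case: ifP; rewrite lexx ?orbT. Qed.

Lemma value_nonincreasing k i : (i < n)%N ->
  (\int[mix]_w (V k (xi theta i.+1 w) (1 - xi theta i.+1 w) (fund i.+1 w))%:E <=
   \int[mix]_w (V k.+1 (xi theta i w) (1 - xi theta i w) (fund i w))%:E)%E.
Proof.
move=> ilt; have [ib ->] := value_step k i ilt.
apply: le_integral => //; first by apply: integrable_value; exact: ltnW.
by move=> w _; rewrite lee_fin branch_le_value.
Qed.

Let terminal_value : (\int[mix]_w (phi (fund n w))%:E =
  \int[mix]_w (V 0 (xi theta n w) (1 - xi theta n w) (fund n w))%:E)%E.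
Proof. by apply: eq_integral => w _ /=; rewrite addrC subrK mul1r. Qed.

Let initial_value : (\int[mix]_w (V n (xi theta 0 w) (1 - xi theta 0 w) (fund 0 w))%:E =
  \int[mix]_w (V n a%:num (1 - a%:num) x)%:E)%E.
Proof. by apply: eq_integral => w _; rewrite /fund /total_payoff big_ord0 addr0. Qed.

Lemma total_utility_le :
  (\int[mix]_w (phi (fund n w))%:E <= \int[mix]_w (V n a%:num (1 - a%:num) x)%:E)%E.
Proof.
suff: forall m, (m <= n)%N -> (\int[mix]_w (phi (fund n w))%:E <=
    \int[mix]_w (V m (xi theta (n - m) w) (1 - xi theta (n - m) w)
      (fund (n - m) w))%:E)%E.
  by move=> /(_ n (leqnn n)); rewrite subnn initial_value.
elim=> [_|m IH mn]; first by rewrite subn0 terminal_value.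
apply: (le_trans (IH (ltnW mn))).
have -> : (n - m = (n - m.+1).+1)%N by rewrite subnSK.
by apply: value_nonincreasing; rewrite ltn_subrL (leq_trans _ mn).
Qed.

Hypothesis f1_better :
  forall u, \int[mu]_s (phi (u + s) * f2 s) <= \int[mu]_s (phi (u + s) * f1 s).

Lemma total_utility_myopic :
  (forall i w, (i < n)%N -> theta i w = (2^-1 <= xi theta i w)) ->
  (\int[mix]_w (phi (fund n w))%:E = \int[mix]_w (V n a%:num (1 - a%:num) x)%:E)%E.
Proof.
move=> myopicE; suff: forall m, (m <= n)%N -> (\int[mix]_w (phi (fund n w))%:E =
    \int[mix]_w (V m (xi theta (n - m) w) (1 - xi theta (n - m) w)
      (fund (n - m) w))%:E)%E.
  by move=> /(_ n (leqnn n)); rewrite subnn initial_value.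
elim=> [_|m IH mn]; first by rewrite subn0 terminal_value.
rewrite (IH (ltnW mn)).
have -> : (n - m = (n - m.+1).+1)%N by rewrite subnSK.
have ilt : (n - m.+1 < n)%N by rewrite ltn_subrL (leq_trans _ mn).
rewrite (value_step m _ ilt).2; apply: eq_integral => w _; congr EFin.
have /andP[xi0 xi1] := posterior_01 _ w (ltnW ilt).
rewrite /branch myopicE//; case: ifPn => half.
  rewrite (bandit_value_left _ _ _ mf1 mf2 f1_ge0 f2_ge0 mphi fin f1_better)//.
  by rewrite subr_ge0 xi1 /=; lra.
rewrite (bandit_value_right _ _ _ mf1 mf2 f1_ge0 f2_ge0 mphi fin f1_better)//.
by rewrite xi0 /=; move: half; rewrite -ltNge; lra.
Qed.

Lemma expected_utility_mixture : b%:num = 1 - a%:num ->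
  expected_utility P1 P2 X Y phi a%:num n x theta =
  (\int[mix]_w (phi (fund n w))%:E)%E.
Proof.
move=> bE; have [i1 i2] := utility_integrable hphi x st.
by rewrite integral_mixture// /expected_utility unlock bE.
Qed.

End play.
End optimal_play.

(** * Optimality of the myopic strategy *)

Section optimality.
Context {R : realType} {d : measure_display} {Omega : measurableType d}.
Variables (P1 P2 : probability Omega R) (X Y : nat -> {mfun Omega >-> R}).
Variables (F1 F2 : probability (measurableTypeR R) R) (f1 f2 phi : R -> R).
Hypothesis hmodel : bandit_model P1 P2 X Y F1 F2 f1 f2.
Hypothesis hphi : suitable_utility P1 P2 X Y phi.
Local Notation mu := (@lebesgue_measure R).
Local Notation M xi := (myopic X Y f1 f2 xi).

Let mf1 : measurable_fun [set: R] f1. Proof. by case: (density1 hmodel). Qed.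
Let mf2 : measurable_fun [set: R] f2. Proof. by case: (density2 hmodel). Qed.
Let f1_ge0 s : 0 <= f1 s. Proof. by case: (density1 hmodel). Qed.
Let f2_ge0 s : 0 <= f2 s. Proof. by case: (density2 hmodel). Qed.
Let mphi := utility_measurable hphi.

Lemma myopic_strategy xi n : strategy X Y n (M xi).
Proof.
apply/strategyP => i _; apply/adapted_boolP.
suff mp : forall k, measurable_fun
    (setT : set (sigma_beforeType (payoff X Y (M xi)) k))
    (myopic_posterior X Y f1 f2 xi k).
  by apply: measurable_fun_ler => //; exact: mp.
elim=> [|k IH]; first exact: measurable_cst.
have mk := measurable_sigma_beforeW _ _ _ _ (leqnSn k) IH.
have mz := measurable_sigma_before (payoff X Y (M xi)) k.+1 k (ltnSn k).
have mb := measurable_fun_ler (measurable_cst (2^-1 : R)) mk.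
exact (measurable_posterior_step _ _ _ _ _ mf1 mf2 mk mz mb).
Qed.

Let arm_mean (f : R -> R) (u : R) : R := \int[mu]_s (phi (u + s) * f s).

Lemma integrable_arm (c : bool) u : P1.-integrable setT
  (fun w => (phi (u + if c then X 0%N w else Y 0%N w))%:E).
Proof.
have st0 : strategy X Y 0 (fun _ _ => true) by [].
have [+ _] := utility_integrable hphi u (strategy_extend_const X Y _ c 0 st0).
congr (integrable _ _ _); apply/funext => w.
rewrite (total_payoff_extend _ _ (fun _ _ => true) (fun=> c)).
rewrite /total_payoff big_ord0 add0r.
by case: c.
Qed.

Lemma expectation_arm (c : bool) u :
  (\int[mu]_s (phi (u + s) * (if c then f1 else f2) s)%:E)%E =
    (arm_mean (if c then f1 else f2) u)%:E /\
  ('E_P1[fun w => phi (u + if c then X 0%N w else Y 0%N w)] =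
   (arm_mean (if c then f1 else f2) u)%:E)%E.
Proof.
pose k : nat + nat := if c then inl 0%N else inr 0%N.
have kE : all_payoffs X Y k = (if c then X 0%N else Y 0%N) by rewrite /k; case: (c).
have F_dens : is_density_of (if c then f1 else f2) (if c then F1 else F2).
  by case: (c); [exact: (density1 hmodel)|exact: (density2 hmodel)].
have k_law : has_law P1 (all_payoffs X Y k) (if c then F1 else F2).
  by rewrite kE; case: (c);
    [exact: (law_X_H1 hmodel)|exact: (law_Y_H1 hmodel)].
have ic : P1.-integrable setT (fun w => (phi (u + all_payoffs X Y k w))%:E).
  have := integrable_arm c u; rewrite kE; congr (integrable _ _ _).
  by apply/funext => w; case: (c).
have [] := integral_next_arm_integrable P1 X Y 0 k _ _ (fun=> tt)
  (fun q => phi (u + q.2)) (indep_H1 hmodel) (leq0n _) F_dens k_law _ _ ic.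
- by apply/adaptedP; exact: measurable_cst.
- by apply: measurableT_comp => //; exact: measurable_funD.
move=> /= /(integrable_fin_num measurableT).
rewrite !integral_probability_cst => ifin E.
have intE : (\int[mu]_s (phi (u + s) * (if c then f1 else f2) s)%:E)%E =
    (arm_mean (if c then f1 else f2) u)%:E.
  by rewrite /arm_mean /Rintegral fineK// ifin.
split=> //; rewrite -intE -E unlock; apply: eq_integral => w _.
by rewrite kE; case: (c).
Qed.

Lemma myopic_optimal xi n x : 0 <= xi <= 1 ->
  (forall u, arm_mean f2 u <= arm_mean f1 u) ->
  optimal P1 P2 X Y phi xi n x (M xi).
Proof.
move=> /andP[xi0 xi1] better.
have xi1' : 0 <= 1 - xi by rewrite subr_ge0.
pose a := NngNum xi0; pose b := NngNum xi1'.
have ab1 : a%:num + b%:num = 1 by rewrite /= addrC subrK.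
have stM := myopic_strategy xi n; split=> //.
have EM theta (st : strategy X Y n theta) :=
  expected_utility_mixture P1 P2 X Y phi hphi a b theta n x st erefl.
apply/eqP; rewrite eq_le; apply/andP; split.
  by apply: ereal_sup_ubound; exists (M xi).
apply: ge_ereal_sup => _ [theta st <-].
rewrite [leLHS]EM// [leRHS]EM//.
rewrite (total_utility_myopic _ _ _ _ _ _ _ _ _ hmodel hphi a b ab1 _ _ _ stM better).
  exact: (total_utility_le _ _ _ _ _ _ _ _ _ hmodel hphi a b ab1 _ _ _ st).
by move=> i w _; exact: myopicE.
Qed.

Lemma arm_mean_continuous (c : bool) : continuous (arm_mean (if c then f1 else f2)).
Proof.
move=> u; have Ec : (fun v => 'E_P1[fun w => phi (v + if c then X 0%N w else Y 0%N w)])%E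
    = EFin \o arm_mean (if c then f1 else f2).
  by apply/funext => v; rewrite (expectation_arm c v).2.
apply/(@fine_cvg _ _ _ _ (EFin \o arm_mean (if c then f1 else f2))).
rewrite -Ec -(expectation_arm c u).2; case: (c).
- exact: (utility_continuous_X hphi).
- exact: (utility_continuous_Y hphi).
Qed.

Lemma myopic_posterior_certain :
  {ae P1, forall w, forall i, myopic_posterior X Y f1 f2 1 i w = 1}.
Proof.
have X_pos : {ae P1, forall w, forall i, f1 (X i w) != 0}.
  apply/ae_foralln => i.
  have m0 : measurable [set s | f1 s = 0].
    by have := mf1 measurableT [set 0] (measurable_set1 0); rewrite setTI.
  exists (X i @^-1` [set s | f1 s = 0]); split.
  - by rewrite -[X in measurable X]setTI; exact: measurable_funP.
  - have [_ _ Ff] := density1 hmodel.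
    transitivity (F1 [set s | f1 s = 0]); first exact: (law_X_H1 hmodel).
    by rewrite Ff//; apply: integral0_eq => s /= ->.
  - by move=> w /= /negP; rewrite negbK => /eqP.
apply: filterS X_pos => w X_pos; elim=> [//|i /= ->].
have -> : 2^-1 <= 1 :> R by lra.
by rewrite /posterior_step subrr mul0r addr0 mul1r divff.
Qed.

Lemma some_ball_charged (T : Omega -> R) (u e : R) :
  measurable_fun setT T -> 0 < e ->
  exists x, (0 < P1 [set w | (`|u - (x + T w)| < e)%R])%E.
Proof.
move=> mT e0; apply: contrapT => noball.
have ball0 x : P1.-negligible [set w | `|u - (x + T w)| < e].
  apply/(negligibleP P1).
    have mdist : measurable_fun setT (fun w => `|u - (x + T w)|).
      apply: measurableT_comp => //; apply: measurable_funB => //.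
      exact: measurable_funD.
    have := measurable_fun_ltr mdist (measurable_cst e) measurableT.
    by move=> /(_ [set true] I); rewrite setTI.
  apply/eqP; rewrite eq_le measure_ge0 andbT leNgt; apply/negP => pos.
  by apply: noball; exists x.
pose B k : set Omega := [set w | `|u - ((u - k%:R * e) + T w)| < e] `|`
  [set w | `|u - ((u + k%:R * e) + T w)| < e].
have : P1.-negligible (\bigcup_k B k).
  by apply: negligible_bigcup => k; apply: negligibleU.
have -> : \bigcup_k B k = setT.
  apply/seteqP; split => // w _.
  have /trunc_itv : 0 <= `|T w| / e by rewrite divr_ge0// ltW.
  set k := Num.trunc _ => /andP[]; rewrite ler_pdivlMr// ltr_pdivrMr// => kT Tk.
  exists k => //; move: kT Tk; rewrite -natr1 mulrDl mul1r.
  have [T0|T0] := leP 0 (T w).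
    rewrite ger0_norm// => kT Tk; left => /=.
    by rewrite ltr_norml; lra.
  rewrite ltr0_norm// => kT Tk; right => /=.
  by rewrite ltr_norml; lra.
move/(negligibleP P1 measurableT) => P1T.
have : (P1 setT = 1)%E := probability_setT P1.
by rewrite P1T => /eqP; rewrite eqe eq_sym oner_eq0.
Qed.

Lemma last_trial (theta : nat -> Omega -> bool) m x (c : R -> bool) :
  let T := total_payoff X Y theta m in
  let theta' := fun j w => if (j < m)%N then theta j w else c (T w) in
  let mean w := if c (T w) then arm_mean f1 (x + T w) else arm_mean f2 (x + T w) in
  measurable_fun setT c -> strategy X Y m.+1 theta' ->
  P1.-integrable setT (EFin \o mean) /\
  (\int[P1]_w (phi (x + total_payoff X Y theta' m.+1 w))%:E = \int[P1]_w (mean w)%:E)%E.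
Proof.
move=> T theta' mean mc st'.
have totalE j : (j <= m)%N -> total_payoff X Y theta' j = total_payoff X Y theta j.
  move=> jm; apply/funext => w; apply: eq_bigr => k _.
  by rewrite eq_payoff_lt// (leq_trans (ltn_ord k)).
have hT : past_measurable X Y m T.
  rewrite /T -(totalE m)//; apply/adaptedP.
  by apply: measurable_pairs_total => j jm; have [] := st' j (ltnW jm).
have mT := past_measurable_fun _ _ _ _ hT.
pose Z w := if c (T w) then X m w else Y m w.
pose kern (q : R * R) := arm_density f1 f2 (c q.1) q.2.
pose g (q : R * R) := phi (x + (q.1 + q.2)).
have gE w : phi (x + total_payoff X Y theta' m.+1 w) = g (T w, Z w).
  by rewrite (total_payoff_extend _ _ theta (c \o T)).
have mZ : measurable_fun setT Z.
  by apply: measurable_fun_ifT => //; exact: measurableT_comp.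
have mkern : measurable_fun setT kern.
  by apply: measurable_fun_ifT; exact: measurableT_comp.
have mg : measurable_fun setT g.
  by apply: measurableT_comp => //; apply: measurable_funD => //; exact: measurable_funD.
have ig : P1.-integrable setT (fun w => (g (T w, Z w))%:E).
  have [+ _] := utility_integrable hphi x st'.
  by congr (integrable _ _ _); apply/funext => w; rewrite gE.
have kern0 q : 0 <= kern q by rewrite /kern /arm_density; case: ifP.
under eq_integral do rewrite gE.
have disint g' := integral_next_payoff P1 X Y F1 F2 f1 f2 (density1 hmodel)
  (density2 hmodel) (law_X_H1 hmodel) (law_Y_H1 hmodel) (indep_H1 hmodel) m T c g' hT mc.
have := integral_disintegration P1 T Z kern mT mkern kern0 disint g mg ig.
rewrite (_ : (fun w => \int[mu]_s _)%E = EFin \o mean) => [//|].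
apply/funext => w; rewrite /= /mean.
transitivity (\int[mu]_s (phi (x + T w + s) * (if c (T w) then f1 else f2) s)%:E)%E.
  apply: eq_integral => s _; rewrite /g /kern /arm_density/= addrA.
  by case: ifP.
by rewrite (expectation_arm (c (T w)) (x + T w)).1; case: ifP.
Qed.

(* With prior 1 the myopic strategy always plays X. If [f2] were better at fund
   [u], hence on a ball around [u], it would pay to deviate to Y in the last
   trial when the fund lies in this ball; a suitable initial fund gives this
   event positive probability. *)
Lemma optimal_arm_mean m :
  (forall x, optimal P1 P2 X Y phi 1 m.+1 x (M 1)) ->
  forall u, arm_mean f2 u <= arm_mean f1 u.
Proof.
move=> opt u; rewrite leNgt; apply/negP => lt_u.
have [e /= e0 he] : nbhs_ball u [set v | arm_mean f1 v < arm_mean f2 v].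
  apply/nbhs_ballP.
  have cvg_diff : arm_mean f2 v - arm_mean f1 v @[v --> u] -->
      arm_mean f2 u - arm_mean f1 u.
    by apply: cvgB; [exact: (arm_mean_continuous false)|
                     exact: (arm_mean_continuous true)].
  have := cvgr_gt _ cvg_diff 0; rewrite subr_gt0 => /(_ _ lt_u).
  by apply: filterS => v; rewrite subr_gt0.
pose always_X := (fun _ _ => true) : nat -> Omega -> bool.
have stX k : strategy X Y k always_X.
  by apply/strategyP => i _; apply/adapted_boolP; exact: measurable_cst.
pose T := total_payoff X Y always_X m.
have mTpayoff : measurable_fun
    (setT : set (sigma_beforeType (payoff X Y always_X) m)) T.
  by apply: measurable_sum => j; exact: measurable_sigma_before.
have mT : measurable_fun setT T.
  apply: (past_measurable_fun X Y m); apply/adaptedP.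
  by apply: measurable_pairs_total => j jm; have [] := stX m j jm.
have [x Cpos] := some_ball_charged T u e mT e0.
pose c t := e <= `|u - (x + t)|.
have mc : measurable_fun setT c.
  apply: measurable_fun_ler => //; apply: measurableT_comp => //.
  by apply: measurable_funB => //; exact: measurable_funD.
have st' : strategy X Y m.+1
    (fun j w => if (j < m)%N then always_X j w else c (T w)).
  apply: (strategy_extend X Y always_X (c \o T) m) => //.
  by apply/adapted_boolP; exact: measurableT_comp.
have [ic Ec] := last_trial always_X m x c mc st'.
have [iX EX] := last_trial always_X m x (fun=> true) (measurable_cst _)
  (strategy_extend_const X Y always_X true m (stX m)).
have utility1 theta : expected_utility P1 P2 X Y phi 1 m.+1 x theta =
    (\int[P1]_w (phi (x + total_payoff X Y theta m.+1 w))%:E)%E.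
  by rewrite /expected_utility subrr mul0e adde0 mul1e unlock.
have myopicX : (\int[P1]_w (phi (x + total_payoff X Y (M 1) m.+1 w))%:E =
    \int[P1]_w (phi (x + total_payoff X Y
      (fun j w => if (j < m)%N then always_X j w else true) m.+1 w))%:E)%E.
  have [iM _] := utility_integrable hphi x (myopic_strategy 1 m.+1).
  have [iA _] := utility_integrable hphi x
    (strategy_extend_const X Y always_X true m (stX m)).
  apply: ae_eq_integral => //; [exact: measurable_int iM|exact: measurable_int iA|].
  apply: filterS myopic_posterior_certain => w posterior1 _.
  congr (phi (x + _))%:E; apply: eq_bigr => j _; rewrite /payoff /myopic posterior1.
  have -> : 2^-1 <= 1 :> R by lra.
  by rewrite /always_X if_same.
have le_c : (\int[P1]_w (if c (T w) then arm_mean f1 (x + T w)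
    else arm_mean f2 (x + T w))%:E <= \int[P1]_w (arm_mean f1 (x + T w))%:E)%E.
  rewrite -Ec -EX -myopicX -!utility1; have [_ ->] := opt x.
  by apply: ereal_sup_ubound; exists (fun j w => if (j < m)%N then always_X j w else c (T w)).
pose gap w := (if c (T w) then arm_mean f1 (x + T w) else arm_mean f2 (x + T w)) -
  arm_mean f1 (x + T w).
have c_ball w : ~~ c (T w) -> arm_mean f1 (x + T w) < arm_mean f2 (x + T w).
  by rewrite -ltNge => near_u; apply: he; exact: near_u.
have gap0 w : 0 <= gap w.
  rewrite /gap; case: ifPn => [_|/c_ball]; first by rewrite subrr.
  by rewrite subr_ge0; exact: ltW.
have igap : P1.-integrable setT (EFin \o gap) by exact: (integrableB _ ic iX).
have gap_null : (\int[P1]_w `|(gap w)%:E| = 0)%E.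
  apply/eqP; rewrite eq_le integral_ge0// andbT.
  under eq_integral do rewrite gee0_abs ?lee_fin//.
  rewrite [leLHS](integralB _ ic iX)// sube_le0//.
have := (ae_eq_integral_abs P1 measurableT (measurable_int _ igap)).1 gap_null.
move=> [N [mN N0 gapN]].
have : (P1 [set w | (`|u - (x + T w)| < e)%R] <= P1 N)%E.
  apply: le_measure; rewrite ?inE//.
    have := (measurableT_comp mc mT) measurableT [set false] I.
    rewrite setTI; congr measurable; apply/seteqP.
    by split=> w /=; rewrite /c ltNge; [move=> ->|move/negbTE].
  move=> w /= near_u; apply: gapN => /= /(_ I) [].
  have nc : ~~ c (T w) by rewrite -ltNge.
  rewrite /gap (negbTE nc) => /eqP; rewrite subr_eq0 => /eqP eq_mean.
  by have := c_ball w nc; rewrite eq_mean ltxx.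
by rewrite N0 leNgt Cpos.
Qed.

End optimality.

Theorem theorem3p2 (R : realType) (d : measure_display)
    (Omega : measurableType d) (P1 P2 : probability Omega R)
    (X Y : nat -> {mfun Omega >-> R})
    (F1 F2 : probability (measurableTypeR R) R) (f1 f2 : R -> R)
    (phi : R -> R)
    (hmodel : bandit_model P1 P2 X Y F1 F2 f1 f2)
    (hphi : suitable_utility P1 P2 X Y phi)
    (n : nat) (hn : (1 <= n)%N) :
  (forall xi0 x : R, 0 <= xi0 <= 1 ->
     optimal P1 P2 X Y phi xi0 n x (myopic X Y f1 f2 xi0))
  <->
  (forall u : R,
     ('E_P1[fun w => phi (u + X 0%N w)%R] >= 'E_P1[fun w => phi (u + Y 0%N w)%R])%E).
Proof.
have [_ EX] := all_and2 (expectation_arm P1 P2 X Y F1 F2 f1 f2 phi hmodel hphi true).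
have [_ EY] := all_and2 (expectation_arm P1 P2 X Y F1 F2 f1 f2 phi hmodel hphi false).
split=> [opt u|better xi0 x xi01].
  rewrite EX EY lee_fin; case: n hn opt => // m _ opt.
  apply: (optimal_arm_mean P1 P2 X Y F1 F2 f1 f2 phi hmodel hphi m) => y.
  by apply: opt; rewrite ler01 lexx.
apply: (myopic_optimal P1 P2 X Y F1 F2) => // u.
by rewrite -lee_fin -EX -EY.
Qed.
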